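(* The twisted Yangian ${}^\imath\mathscr Y$ (in Drinfeld presentation, associated with $\mathfrak g$) is isomorphic to the unital associative algebra generated by $h_{i,1},b_{i,0},b_{i,1}$ for $i\in\mathbb I$ subject only to the relations, for $i,j\in\mathbb I$, $$[h_{i,1},h_{j,1}]=0,\qquad [h_{i,1},b_{j,0}]=2(\alpha_i,\alpha_j)b_{j,1},$$ $$[b_{i,1},b_{j,0}]-[b_{i,0},b_{j,1}]=\tfrac12(\alpha_i,\alpha_j)\{b_{i,0},b_{j,0}\}-2\delta_{ij}h_{i,1},$$ together with the finite Serre type relations (for $i\neq j$) $$[b_{i,0},b_{j,0}]=0\ (c_{ij}=0),\qquad \mathrm{ad}(b_{i,0})^2(b_{j,0})=-d_ib_{j,0}\ (c_{ij}=-1),$$ $$\mathrm{ad}(b_{i,0})^3(b_{j,0})=-4d_i[b_{i,0},b_{j,0}]\ (c_{ij}=-2),$$ $$\mathrm{ad}(b_{i,0})^4(b_{j,0})=-10d_i[b_{i,0},[b_{i,0},b_{j,0}]]-9d_i^2b_{j,0}\ (c_{ij}=-3),$$ where, if $\mathfrak g$ is of type $\mathsf A_1$, $\mathsf B_2\cong\mathsf C_2$, or $\mathsf G_2$, the additional relation $$\Big[h_{i,1},\big[b_{i,1},[h_{i,1},b_{i,1}]\big]\Big]=(\alpha_i,\alpha_i)^2\big[b_{i,1}^2,h_{i,1}\big]$$ for one single $i\in\mathbb I$ (any choice of $i$ is allowed) is included among the defining relations.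
   Context: All algebras are over $\mathbb C$, $\mathbb N=\{0,1,2,\dots\}$, $\{x,y\}=xy+yx$, $\mathrm{ad}(x)(y)=[x,y]$. Let $\mathfrak g$ be a finite-dimensional simple complex Lie algebra with Cartan matrix $(c_{ij})_{i,j\in\mathbb I}$, simple roots $\alpha_i$, a fixed invariant inner product $(\cdot,\cdot)$, and $d_i=\frac12(\alpha_i,\alpha_i)$, so that $d_ic_{ij}=(\alpha_i,\alpha_j)$. The twisted Yangian ${}^\imath\mathscr Y$ in Drinfeld presentation (of split type) is the unital associative algebra generated by $h_{i,2r+1},b_{i,r}$ ($i\in\mathbb I$, $r\in\mathbb N$) subject to the relations, for $i,j\in\mathbb I$, $r,s\in\mathbb N$, $$[h_{i,r},h_{j,s}]=0,$$ $$[h_{i,r+1},b_{j,s}]-[h_{i,r-1},b_{j,s+2}]=(\alpha_i,\alpha_j)\{h_{i,r-1},b_{j,s+1}\}+\tfrac14(\alpha_i,\alpha_j)^2[h_{i,r-1},b_{j,s}],$$ $$[b_{i,r+1},b_{j,s}]-[b_{i,r},b_{j,s+1}]=\tfrac12(\alpha_i,\alpha_j)\{b_{i,r},b_{j,s}\}-2\delta_{ij}(-1)^sh_{i,r+s+1},$$ and the same finite Serre type relations in the $b_{i,0}$ as listed in the claim, where $h_{i,-1}=1$ and $h_{i,r}=0$ if $r$ is even or $r<-1$. *)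

(* Defs.v *)
From HB Require Import structures.
From mathcomp Require Import all_boot all_order all_algebra generic_quotient.
From mathcomp Require Import boolp classical_sets reals.
From mathcomp Require Import complex.
From mathcomp Require Import finmap monalg.

Set Implicit Arguments.
Unset Strict Implicit.
Unset Printing Implicit Defensive.

Import Order.TTheory GRing.Theory Num.Theory.
Local Open Scope ring_scope.
Local Open Scope quotient_scope.

HB.mixin Record Vector_isLieAlgebra (F : fieldType) L of Vector F L := {
  lie : L -> L -> L;
  lie_linearl : forall y, linear (lie ^~ y);
  lie_linearr : forall x, linear (lie x);
  liexx : forall x, lie x x = 0;
  lie_jacobi : forall x y z,
    lie x (lie y z) + lie y (lie z x) + lie z (lie x y) = 0
}.

#[short(type="lieAlgType")]
HB.structure Definition LieAlgebra (F : fieldType) :=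
  {L of Vector F L & Vector_isLieAlgebra F L}.

Section LieTheory.
Variables (R : realType) (g : lieAlgType R[i]).

Definition lie_ideal (J : {vspace g}) : Prop :=
  forall x y : g, y \in J -> lie x y \in J.

Definition simple_lie : Prop :=
  (exists x y : g, lie x y != 0) /\
  (forall J : {vspace g}, lie_ideal J -> J = 0%VS \/ J = fullv).

Definition ad_diagonalizable (x : g) : Prop :=
  exists2 e : seq g, basis_of fullv e &
    forall v, v \in e -> exists c : R[i], lie x v = c *: v.

(* This characterizes Cartan subalgebras for semisimple g only; in general they
   are nilpotent and self-normalizing. *)
Record cartan_subalgebra (H : {vspace g}) : Prop := CartanSubalgebra {
  cartan_abelian : forall x y, x \in H -> y \in H -> lie x y = 0;
  cartan_maximal : forall x, (forall y, y \in H -> lie y x = 0) -> x \in H;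
  cartan_diagonalizable : forall x, x \in H -> ad_diagonalizable x
}.

Definition dual_of (H : {vspace g}) := 'Hom(subvs_of H, R[i]^o).

Section Roots.
Variable H : {vspace g}.

Definition is_root (lambda : dual_of H) : Prop :=
  lambda != 0 /\
  exists2 x : g, x != 0 &
    forall h : subvs_of H, lie (vsval h) x = lambda h *: x.

Record simple_roots (I : finType) (alpha : I -> dual_of H) : Prop :=
  SimpleRoots {
  simple_basis : basis_of fullv [seq alpha i | i : I];
  simple_root : forall i, is_root (alpha i);
  simple_sign : forall beta, is_root beta ->
    exists n : I -> nat,
      beta = \sum_i alpha i *+ n i \/ beta = - \sum_i alpha i *+ n i
}.

(* The element of H representing lambda, unique when the form is
   nondegenerate on H. *)
Definition form_rep (form : g -> g -> R[i]) (lambda : dual_of H) : g :=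
  xget 0 [set t | t \in H /\
                  forall h : subvs_of H, form t (vsval h) = lambda h].

Definition dual_form (form : g -> g -> R[i]) (lambda mu : dual_of H) : R[i] :=
  form (form_rep form lambda) (form_rep form mu).

(* An invariant symmetric bilinear form on g whose transport to the dual of H
   is positive definite on the real span of the roots.  In the order of R[i],
   0 < z says that z is a positive real number. *)
Record invariant_inner_product (I : finType) (alpha : I -> dual_of H)
    (form : g -> g -> R[i]) : Prop := InvariantInnerProduct {
  form_sym : forall x y, form x y = form y x;
  form_linear : forall x, linear (form x : g -> R[i]^o);
  form_invariant : forall x y z, form (lie x y) z = form x (lie y z);
  form_positive : forall c : I -> R, (exists i, c i != 0) ->
    let lambda := \sum_i ((c i)%:C)%C *: alpha i in
    0 < dual_form form lambda lambda
}.

End Roots.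

End LieTheory.

Section CartanMatrix.
Variables (K : fieldType) (I : finType) (ip : I -> I -> K).

(* With ip i j = (alpha_i, alpha_j), these are d_i and c_{ij}, the latter solved
   from d_i c_{ij} = (alpha_i, alpha_j). *)
Definition half_norm (i : I) : K := ip i i / 2.

Definition cartan_entry (i j : I) : K := ip i j / half_norm i.

(* M is the Cartan matrix up to relabelling; hence B2 and C2 coincide. *)
Definition has_type (n : nat) (M : 'M[int]_n) : Prop :=
  exists2 s : 'I_n -> I, bijective s &
    forall k l, cartan_entry (s k) (s l) = (M k l)%:~R.

Definition cartan_A1 : 'M[int]_1 := 2%:M.

Definition cartan_B2 : 'M[int]_2 := \matrix_(k, l)
  if k == l then 2 else if k == 0 then - 2 else - 1.

Definition cartan_G2 : 'M[int]_2 := \matrix_(k, l)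
  if k == l then 2 else if k == 0 then - 3 else - 1.

Definition A1_B2_or_G2 : Prop :=
  [\/ has_type cartan_A1, has_type cartan_B2 | has_type cartan_G2].

End CartanMatrix.

Record proper_ideal (A : nzRingType) := ProperIdeal {
  ideal_mem :> A -> Prop;
  ideal_mem0 : ideal_mem 0;
  ideal_memD : forall x y, ideal_mem x -> ideal_mem y -> ideal_mem (x + y);
  ideal_memMl : forall a x, ideal_mem x -> ideal_mem (a * x);
  ideal_memMr : forall a x, ideal_mem x -> ideal_mem (x * a);
  ideal_mem1 : ~ ideal_mem 1
}.

Section IdealQuotient.
Variables (K : comNzRingType) (A : algType K) (J : proper_ideal A).

Definition ideal_equiv (x y : A) : bool := `[< J (x - y) >].

Lemma ideal_memN x : J x -> J (- x).
Proof. by move=> Jx; rewrite -mulN1r; exact: ideal_memMl. Qed.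

Lemma ideal_memZ c x : J x -> J (c *: x).
Proof. by move=> Jx; rewrite -[x]mul1r scalerAl; exact: ideal_memMl. Qed.

Lemma ideal_equiv_is_equiv : equiv_class_of ideal_equiv.
Proof.
split=> [x|x y|y x z].
- by apply/asboolP; rewrite subrr; exact: ideal_mem0.
- by apply/asboolP/asboolP => /ideal_memN; rewrite opprB.
- move=> /asboolP xy /asboolP yz; apply/asboolP.
  by rewrite -(subrKA y); exact: ideal_memD.
Qed.

Canonical ideal_equiv_equiv := EquivRelPack ideal_equiv_is_equiv.
Canonical ideal_equiv_encModRel := defaultEncModRel ideal_equiv.

Definition alg_quot : Type := {eq_quot ideal_equiv}.

HB.instance Definition _ := Choice.on alg_quot.
HB.instance Definition _ := EqQuotient.on alg_quot.

Definition alg_pi (x : A) : alg_quot := \pi_alg_quot x.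

Lemma alg_piP x y : reflect (J (x - y)) (alg_pi x == alg_pi y).
Proof. by rewrite /alg_pi piE /=; exact: asboolP. Qed.

Lemma alg_pi_eq x y : J (x - y) -> alg_pi x = alg_pi y.
Proof. by move=> h; exact/eqP/alg_piP. Qed.

Lemma alg_pi_repr u : alg_pi (repr u) = u.
Proof. exact: reprK. Qed.

Lemma alg_repr_pi x : J (repr (alg_pi x) - x).
Proof. by apply/alg_piP; rewrite alg_pi_repr. Qed.

Definition quot_add (u v : alg_quot) : alg_quot := alg_pi (repr u + repr v).
Definition quot_opp (u : alg_quot) : alg_quot := alg_pi (- repr u).
Definition quot_mul (u v : alg_quot) : alg_quot := alg_pi (repr u * repr v).
Definition quot_scale (c : K) (u : alg_quot) : alg_quot := alg_pi (c *: repr u).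

Lemma quot_addE x y : quot_add (alg_pi x) (alg_pi y) = alg_pi (x + y).
Proof.
apply: alg_pi_eq; rewrite opprD addrACA.
by apply: ideal_memD; exact: alg_repr_pi.
Qed.

Lemma quot_oppE x : quot_opp (alg_pi x) = alg_pi (- x).
Proof.
by apply: alg_pi_eq; rewrite -opprD; apply: ideal_memN; exact: alg_repr_pi.
Qed.

Lemma quot_mulE x y : quot_mul (alg_pi x) (alg_pi y) = alg_pi (x * y).
Proof.
apply: alg_pi_eq.
set x' := repr _; set y' := repr _.
have -> : x' * y' - x * y = (x' - x) * y' + x * (y' - y).
  by rewrite mulrBl mulrBr addrA subrK.
by apply: ideal_memD; [apply: ideal_memMr|apply: ideal_memMl];
  exact: alg_repr_pi.
Qed.

Lemma quot_scaleE c x : quot_scale c (alg_pi x) = alg_pi (c *: x).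
Proof.
by apply: alg_pi_eq; rewrite -scalerBr; apply: ideal_memZ; exact: alg_repr_pi.
Qed.

Local Definition quotE := (quot_addE, quot_oppE, quot_mulE, quot_scaleE).

Lemma alg_quotW (P : alg_quot -> Prop) : (forall x, P (alg_pi x)) ->
  forall u, P u.
Proof. by move=> h u; rewrite -(alg_pi_repr u). Qed.

Fact quot_addA : associative quot_add.
Proof.
by elim/alg_quotW=> x; elim/alg_quotW=> y; elim/alg_quotW=> z;
  rewrite !quotE addrA.
Qed.

Fact quot_addC : commutative quot_add.
Proof. by elim/alg_quotW=> x; elim/alg_quotW=> y; rewrite !quotE addrC. Qed.

Fact quot_add0 : left_id (alg_pi 0) quot_add.
Proof. by elim/alg_quotW=> x; rewrite !quotE add0r. Qed.

Fact quot_addN : left_inverse (alg_pi 0) quot_opp quot_add.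
Proof. by elim/alg_quotW=> x; rewrite !quotE addNr. Qed.

HB.instance Definition _ :=
  GRing.isZmodule.Build alg_quot quot_addA quot_addC quot_add0 quot_addN.

Fact quot_mulA : associative quot_mul.
Proof.
by elim/alg_quotW=> x; elim/alg_quotW=> y; elim/alg_quotW=> z;
  rewrite !quotE mulrA.
Qed.

Fact quot_mul1l : left_id (alg_pi 1) quot_mul.
Proof. by elim/alg_quotW=> x; rewrite !quotE mul1r. Qed.

Fact quot_mul1r : right_id (alg_pi 1) quot_mul.
Proof. by elim/alg_quotW=> x; rewrite !quotE mulr1. Qed.

Fact quot_mulDl : left_distributive quot_mul quot_add.
Proof.
by elim/alg_quotW=> x; elim/alg_quotW=> y; elim/alg_quotW=> z;
  rewrite !quotE mulrDl.
Qed.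

Fact quot_mulDr : right_distributive quot_mul quot_add.
Proof.
by elim/alg_quotW=> x; elim/alg_quotW=> y; elim/alg_quotW=> z;
  rewrite !quotE mulrDr.
Qed.

Fact quot_1neq0 : alg_pi 1 != alg_pi 0.
Proof. by apply/alg_piP; rewrite subr0; exact: ideal_mem1. Qed.

HB.instance Definition _ := GRing.Zmodule_isNzRing.Build alg_quot
  quot_mulA quot_mul1l quot_mul1r quot_mulDl quot_mulDr quot_1neq0.

Fact quot_scaleA a b u : quot_scale a (quot_scale b u) = quot_scale (a * b) u.
Proof. by elim/alg_quotW: u => x; rewrite !quotE scalerA. Qed.

Fact quot_scale1 : left_id 1 quot_scale.
Proof. by elim/alg_quotW=> x; rewrite !quotE scale1r. Qed.

Fact quot_scaleDr : right_distributive quot_scale +%R.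
Proof.
move=> a; elim/alg_quotW=> x; elim/alg_quotW=> y.
by rewrite -[+%R]/quot_add !quotE scalerDr.
Qed.

Fact quot_scaleDl u : {morph quot_scale^~ u : a b / a + b}.
Proof.
move=> a b; elim/alg_quotW: u => x.
by rewrite -[(+%R : alg_quot -> _)]/quot_add !quotE scalerDl.
Qed.

HB.instance Definition _ := GRing.Zmodule_isLmodule.Build K alg_quot
  quot_scaleA quot_scale1 quot_scaleDr quot_scaleDl.

Fact quot_scaleAl a (u v : alg_quot) : a *: (u * v) = a *: u * v.
Proof.
elim/alg_quotW: u => x; elim/alg_quotW: v => y.
by rewrite -[*:%R]/quot_scale -[*%R]/quot_mul !quotE scalerAl.
Qed.

HB.instance Definition _ :=
  GRing.Lmodule_isLalgebra.Build K alg_quot quot_scaleAl.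

Fact quot_scaleAr a (u v : alg_quot) : a *: (u * v) = u * (a *: v).
Proof.
elim/alg_quotW: u => x; elim/alg_quotW: v => y.
by rewrite -[*:%R]/quot_scale -[*%R]/quot_mul !quotE scalerAr.
Qed.

HB.instance Definition _ :=
  GRing.Lalgebra_isAlgebra.Build K alg_quot quot_scaleAr.

Fact alg_pi_is_additive : zmod_morphism alg_pi.
Proof. by move=> x y; rewrite -quot_addE -quot_oppE. Qed.
HB.instance Definition _ :=
  GRing.isZmodMorphism.Build A alg_quot alg_pi alg_pi_is_additive.

Fact alg_pi_is_multiplicative : monoid_morphism alg_pi.
Proof. by split=> // x y; rewrite -quot_mulE. Qed.
HB.instance Definition _ :=
  GRing.isMonoidMorphism.Build A alg_quot alg_pi alg_pi_is_multiplicative.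

Fact alg_pi_is_scalable : scalable alg_pi.
Proof. by move=> c x; rewrite -quot_scaleE. Qed.
HB.instance Definition _ :=
  GRing.isScalable.Build K A alg_quot *:%R alg_pi alg_pi_is_scalable.

End IdealQuotient.

Section FreeAlgebra.
Variables (K : comNzRingType) (X : choiceType).

Definition free_alg : Type := {malg K[fmonom X]}.

HB.instance Definition _ := GRing.Lalgebra.on free_alg.

Fact free_scaleAr a (u v : free_alg) : a *: (u * v) = u * (a *: v).
Proof.
rewrite malgME (malgMEw (fsubset_refl _) (msuppZ_le a v)) scaler_sumr.
apply: eq_bigr => k _; rewrite scaler_sumr; apply: eq_bigr => l _.
apply/malgP => m; rewrite [LHS]mcoeffZ [RHS]mcoeffU [X in a * X]mcoeffU.
by rewrite [in RHS]mcoeffZ mulrnAr mulrCA.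
Qed.

HB.instance Definition _ :=
  GRing.Lalgebra_isAlgebra.Build K free_alg free_scaleAr.

Definition free_gen (x : X) : free_alg := << fmu x >>.

Definition free_aug (u : free_alg) : K :=
  mcoeff (mone : fmonom X) (u : {malg K[fmonom X]}).

Fact free_aug_is_additive : zmod_morphism free_aug.
Proof. exact: mcoeffB. Qed.
HB.instance Definition _ :=
  GRing.isZmodMorphism.Build free_alg K free_aug free_aug_is_additive.

Fact free_aug_is_multiplicative : monoid_morphism free_aug.
Proof.
have [h1 hM] := @mcoeff1g_is_multiplicative (fmonom X) K.
by split; [exact: hM|exact: h1].
Qed.
HB.instance Definition _ :=
  GRing.isMonoidMorphism.Build free_alg K free_aug free_aug_is_multiplicative.

Lemma free_augZ c u : free_aug (c *: u) = c * free_aug u.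
Proof. exact: mcoeffZ. Qed.

Lemma free_aug_gen x : free_aug (free_gen x) = 0.
Proof. by rewrite /free_aug mcoeffU1 -fdeg_eq0 fdegU. Qed.

Inductive relation_ideal (E : free_alg -> free_alg -> Prop) : free_alg -> Prop :=
| Relation_ideal_gen x y of E x y : relation_ideal E (x - y)
| Relation_ideal0 : relation_ideal E 0
| Relation_idealD x y of relation_ideal E x & relation_ideal E y :
    relation_ideal E (x + y)
| Relation_idealMl a x of relation_ideal E x : relation_ideal E (a * x)
| Relation_idealMr a x of relation_ideal E x : relation_ideal E (x * a).

Variables (E : free_alg -> free_alg -> Prop).
Hypothesis E_aug : forall x y, E x y -> free_aug x = free_aug y.

Lemma relation_ideal_proper : ~ relation_ideal E 1.
Proof.
suff H x : relation_ideal E x -> free_aug x = 0.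
  by move/H/eqP; rewrite rmorph1 oner_eq0.
elim=> {x} [x y /E_aug xy||x y _ x0 _ y0|a x _ x0|a x _ x0].
- by rewrite rmorphB /= xy subrr.
- exact: rmorph0.
- by rewrite rmorphD /= x0 y0 addr0.
- by rewrite rmorphM /= x0 mulr0.
- by rewrite rmorphM /= x0 mul0r.
Qed.

Definition proper_relation_ideal : proper_ideal free_alg :=
  ProperIdeal (Relation_ideal0 E) (@Relation_idealD E) (@Relation_idealMl E)
    (@Relation_idealMr E) relation_ideal_proper.

(* The algebra with generators X and relations E. Preservation of the constant
   term by E makes it nonzero, as the interface of algebras requires. *)
Definition presented_alg : Type := alg_quot proper_relation_ideal.

HB.instance Definition _ := GRing.Algebra.on presented_alg.

Definition presented_gen (x : X) : presented_alg :=
  alg_pi proper_relation_ideal (free_gen x).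

End FreeAlgebra.

Definition commut (A : nzRingType) (x y : A) : A := x * y - y * x.
Definition anticommut (A : nzRingType) (x y : A) : A := x * y + y * x.

Local Notation "[[ x , y ]]" := (commut x y) (format "[[ x ,  y ]]").
Local Notation "{{ x , y }}" := (anticommut x y) (format "{{ x ,  y }}").

Section Relations.
Variables (K : fieldType) (I : finType) (ip : I -> I -> K) (A : algType K).

Local Notation d := (half_norm ip).
Local Notation c := (cartan_entry ip).

Inductive serre_rel (b0 : I -> A) : A -> A -> Prop :=
| Serre0 i j of i != j & c i j = 0 : serre_rel b0 [[b0 i, b0 j]] 0
| Serre1 i j of i != j & c i j = - 1 :
    serre_rel b0 [[b0 i, [[b0 i, b0 j]]]] (- d i *: b0 j)
| Serre2 i j of i != j & c i j = - 2 :
    serre_rel b0 [[b0 i, [[b0 i, [[b0 i, b0 j]]]]]]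
                 (- (4 * d i) *: [[b0 i, b0 j]])
| Serre3 i j of i != j & c i j = - 3 :
    serre_rel b0 [[b0 i, [[b0 i, [[b0 i, [[b0 i, b0 j]]]]]]]]
                 (- (10 * d i) *: [[b0 i, [[b0 i, b0 j]]]]
                  - (9 * d i ^+ 2) *: b0 j).

(* The family h_{i,r} for r an integer, from hodd i k = h_{i,2k+1}. *)
Definition h_ext (hodd : I -> nat -> A) (i : I) (r : int) : A :=
  match r with
  | Posz n => if odd n then hodd i n./2 else 0
  | Negz 0 => 1
  | Negz _ => 0
  end.

Inductive drinfeld_rel (hodd b : I -> nat -> A) : A -> A -> Prop :=
| Drinfeld_hh i j (r s : nat) :
    let h := h_ext hodd in
    drinfeld_rel hodd b [[h i r, h j s]] 0
| Drinfeld_hb i j (r s : nat) :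
    let h := h_ext hodd in
    drinfeld_rel hodd b
      ([[h i (r%:Z + 1), b j s]] - [[h i (r%:Z - 1), b j s.+2]])
      (ip i j *: {{h i (r%:Z - 1), b j s.+1}}
       + (ip i j ^+ 2 / 4) *: [[h i (r%:Z - 1), b j s]])
| Drinfeld_bb i j (r s : nat) :
    let h := h_ext hodd in
    drinfeld_rel hodd b
      ([[b i r.+1, b j s]] - [[b i r, b j s.+1]])
      ((ip i j / 2) *: {{b i r, b j s}}
       - (2 * (i == j)%:R * (-1) ^+ s) *: h i (r + s).+1)
| Drinfeld_serre x y of serre_rel (b^~ 0%N) x y : drinfeld_rel hodd b x y.

Inductive reduced_rel (i0 : I) (h1 b0 b1 : I -> A) : A -> A -> Prop :=
| Reduced_hh i j : reduced_rel i0 h1 b0 b1 [[h1 i, h1 j]] 0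
| Reduced_hb i j :
    reduced_rel i0 h1 b0 b1 [[h1 i, b0 j]] ((2 * ip i j) *: b1 j)
| Reduced_bb i j :
    reduced_rel i0 h1 b0 b1
      ([[b1 i, b0 j]] - [[b0 i, b1 j]])
      ((ip i j / 2) *: {{b0 i, b0 j}} - (2 * (i == j)%:R) *: h1 i)
| Reduced_serre x y of serre_rel b0 x y : reduced_rel i0 h1 b0 b1 x y
| Reduced_extra of A1_B2_or_G2 ip :
    reduced_rel i0 h1 b0 b1
      [[h1 i0, [[b1 i0, [[h1 i0, b1 i0]]]]]]
      (ip i0 i0 ^+ 2 *: [[b1 i0 ^+ 2, h1 i0]]).

Section Augmentation.
Variable f : {rmorphism A -> K}.
Hypothesis fZ : forall a u, f (a *: u) = a * f u.

Lemma augmentation_commut u v : f [[u, v]] = 0.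
Proof. by rewrite rmorphB !rmorphM mulrC subrr. Qed.

Let fE := (augmentation_commut, rmorphB f, rmorphD f, fZ).

Lemma serre_rel_augmentation b0 x y : (forall i, f (b0 i) = 0) ->
  serre_rel b0 x y -> f x = f y.
Proof.
by move=> fb0; case=> i j _ _; rewrite ?fE ?rmorph0 ?fb0 ?mulr0 ?subrr.
Qed.

Lemma drinfeld_rel_augmentation hodd b x y :
  (forall i r, f (hodd i r) = 0) -> (forall i r, f (b i r) = 0) ->
  drinfeld_rel hodd b x y -> f x = f y.
Proof.
move=> fh fb; case=> {x y} [i j r s h|i j r s h|i j r s h|x y].
- by rewrite fE rmorph0.
- by rewrite !fE !rmorphM fb !(mul0r, mulr0, addr0) subrr.
- rewrite !fE !rmorphM !fb /h /h_ext !(mulr0, addr0) subrr sub0r.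
  by case: ifP => _; rewrite ?fh ?rmorph0 mulr0 oppr0.
- by apply: serre_rel_augmentation => i; exact: fb.
Qed.

Lemma reduced_rel_augmentation i0 h1 b0 b1 x y :
  (forall i, f (h1 i) = 0) -> (forall i, f (b0 i) = 0) ->
  (forall i, f (b1 i) = 0) ->
  reduced_rel i0 h1 b0 b1 x y -> f x = f y.
Proof.
move=> fh fb0 fb1; case=> {x y} [i j|i j|i j|x y|_].
- by rewrite fE rmorph0.
- by rewrite !fE fb1 mulr0.
- by rewrite !fE !rmorphM !fb0 fh !(mulr0, addr0) subrr.
- exact: serre_rel_augmentation.
- by rewrite !fE mulr0.
Qed.

End Augmentation.

End Relations.

Section TwistedYangian.
Variables (K : fieldType) (I : finType) (ip : I -> I -> K).

(* inl (i, k) is h_{i,2k+1} and inr (i, r) is b_{i,r}. *)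
Definition drinfeld_gen : choiceType := (I * nat + I * nat)%type.

Definition free_hodd (i : I) (k : nat) : free_alg K drinfeld_gen :=
  free_gen K (inl (i, k)).
Definition free_b (i : I) (r : nat) : free_alg K drinfeld_gen :=
  free_gen K (inr (i, r)).

Lemma drinfeld_aug x y : drinfeld_rel ip free_hodd free_b x y ->
  free_aug x = free_aug y.
Proof.
apply: (drinfeld_rel_augmentation (f := @free_aug K drinfeld_gen)).
- exact: free_augZ.
- by move=> *; exact: free_aug_gen.
- by move=> *; exact: free_aug_gen.
Qed.

Definition twisted_yangian : Type := presented_alg drinfeld_aug.

HB.instance Definition _ := GRing.Algebra.on twisted_yangian.

Definition yangian_hodd (i : I) (k : nat) : twisted_yangian :=
  presented_gen drinfeld_aug (inl (i, k)).
Definition yangian_b (i : I) (r : nat) : twisted_yangian :=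
  presented_gen drinfeld_aug (inr (i, r)).

(* inl i is h_{i,1}, inr (inl i) is b_{i,0} and inr (inr i) is b_{i,1}. *)
Definition reduced_gen : choiceType := (I + (I + I))%type.

Definition free_h1 (i : I) : free_alg K reduced_gen := free_gen K (inl i).
Definition free_b0 (i : I) : free_alg K reduced_gen :=
  free_gen K (inr (inl i)).
Definition free_b1 (i : I) : free_alg K reduced_gen :=
  free_gen K (inr (inr i)).

Lemma reduced_aug i0 x y : reduced_rel ip i0 free_h1 free_b0 free_b1 x y ->
  free_aug x = free_aug y.
Proof.
apply: (reduced_rel_augmentation (f := @free_aug K reduced_gen)).
- exact: free_augZ.
- by move=> *; exact: free_aug_gen.
- by move=> *; exact: free_aug_gen.
- by move=> *; exact: free_aug_gen.
Qed.

Definition reduced_yangian (i0 : I) : Type := presented_alg (@reduced_aug i0).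

HB.instance Definition _ i0 := GRing.Algebra.on (reduced_yangian i0).

Definition reduced_h1 (i0 i : I) : reduced_yangian i0 :=
  presented_gen (@reduced_aug i0) (inl i).
Definition reduced_b0 (i0 i : I) : reduced_yangian i0 :=
  presented_gen (@reduced_aug i0) (inr (inl i)).
Definition reduced_b1 (i0 i : I) : reduced_yangian i0 :=
  presented_gen (@reduced_aug i0) (inr (inr i)).

End TwistedYangian.

(* Main.v *)
(* In both algebras [h_{i,1}, .] raises every index of b_j by one up to the
   factor 2 (alpha_i, alpha_j), so the reduced generators determine all b_{i,r}
   recursively, and h_{i,2k+1} is read off the b-b relation for i = j.

   Put D_{r,s} = [b_{r+1}, b_s] - [b_r, b_{s+1}] - a/2 {b_r, b_s} for one index
   i, with a = (alpha_i, alpha_i); the b-b relation says that D is supported on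
   "u = -v", that is D_{r+1,s} + D_{r,s+1} = 0, and this sum is
   [h_1, D_{r,s}]/2a.  So in rank one everything amounts to [h_1, h_n] = 0 for
   all n.  Reordering b(u)b(v)b(w) into b(w)b(v)b(u) in two ways turns the b-b
   relations below a given degree into the h-b relations below that degree,
   and these imply that p |-> [h_p, h_{N-p}] is proportional to p for p < N;
   antisymmetry under p |-> N - p then forces it to vanish, once [h_1, h_3] = 0.

   For i <> j the b-b relations follow by solving the two linear equations
   obtained from [h_i, .] and [h_j, .], whose determinant is
   (alpha_i, alpha_i)(alpha_j, alpha_j) - (alpha_i, alpha_j)^2, and the h-b
   relations by the same reordering.  Finally [h_{i,1}, h_{i,3}] = 0 is the
   additional relation in type A1; otherwise i has a neighbour j, and computing
   [h_{i,3}, h_{j,1}] through the action on b_i and through the action on b_j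
   gives c_i = -3 c_j = 9 c_i, where c_i is [h_{i,1}, h_{i,3}] divided by
   (alpha_i, alpha_i).  Such a neighbour exists because the Dynkin diagram of a
   simple Lie algebra is connected. *)

Require Import Defs.
From HB Require Import structures.
From mathcomp Require Import all_boot all_order all_algebra.
From mathcomp Require Import reals complex.
From mathcomp Require Import finmap monalg generic_quotient.
From mathcomp Require Import boolp classical_sets.
From mathcomp Require Import ring zify.

Set Implicit Arguments.
Unset Strict Implicit.
Unset Printing Implicit Defensive.

Import Order.TTheory GRing.Theory Num.Theory.
Local Open Scope ring_scope.

(** * Roots of a simple Lie algebra *)

Section Subspaces.
Variables (F : fieldType) (V : vectType F).

(** A subspace of maximal dimension inside [P] absorbs every vector satisfying [P]. This lets
    simplicity, stated for [{vspace g}], apply to ideals given by a predicate. *)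
Lemma vspace_of_pred (P : V -> Prop) : P 0 ->
  (forall a x y, P x -> P y -> P (a *: x + y)) ->
  exists U : {vspace V}, forall x, x \in U <-> P x.
Proof.
move=> P0 Plin.
pose dimP n := `[< exists2 U : {vspace V},
  \dim U = n & forall x, x \in U -> P x >].
have dimP_bound n : dimP n -> (n <= \dim {:V})%N.
  by case/asboolP=> U <- _; exact/dimvS/subvf.
have dimP0 : exists n, dimP n.
  exists 0%N; apply/asboolP; exists 0%VS; first exact: dimv0.
  by move=> x; rewrite memv0 => /eqP ->.
have [n /asboolP[U dimU UP] max_n] := ex_maxnP dimP0 dimP_bound.
exists U => x; split=> [|Px]; first exact: UP.
have /eqP -> : U == (U + <[x]>)%VS.
  rewrite eqEdim addvSl /= dimU; apply: max_n; apply/asboolP.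
  exists (U + <[x]>)%VS => // _ /memv_addP[u Uu [_ /vlineP[a ->] ->]].
  by rewrite addrC; apply: Plin => //; exact: UP.
exact: subvP (addvSr _ _) _ (memv_line x).
Qed.

End Subspaces.

(** * Bracket calculus and eigenvectors of ad *)

Section LieBasics.
Variables (F : fieldType) (g : lieAlgType F).
Implicit Types x y z : g.

Lemma lieDr x y z : lie x (y + z) = lie x y + lie x z.
Proof. by have := lie_linearr x 1 y z; rewrite !scale1r. Qed.

Lemma lie0r x : lie x 0 = 0 :> g.
Proof. by apply: (addrI (lie x 0)); rewrite -lieDr !addr0. Qed.

Lemma lieZr a x y : lie x (a *: y) = a *: lie x y.
Proof. by have := lie_linearr x a y 0; rewrite lie0r !addr0. Qed.

Lemma lieDl x y z : lie (x + y) z = lie x z + lie y z.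
Proof. by have := lie_linearl z 1 x y; rewrite !scale1r. Qed.

Lemma lie0l x : lie 0 x = 0 :> g.
Proof. by apply: (addrI (lie 0 x)); rewrite -lieDl !addr0. Qed.

Lemma lieZl a x y : lie (a *: x) y = a *: lie x y.
Proof. by have := lie_linearl y a x 0; rewrite lie0l !addr0. Qed.

Lemma lieC x y : lie x y = - lie y x.
Proof.
have := liexx (x + y); rewrite lieDl !lieDr !liexx add0r addr0 => /eqP.
by rewrite addr_eq0 => /eqP.
Qed.

Lemma lieNr x y : lie x (- y) = - lie x y.
Proof. by rewrite -scaleN1r lieZr scaleN1r. Qed.

Lemma lie_derivation x y z :
  lie x (lie y z) = lie (lie x y) z + lie y (lie x z).
Proof.
have /eqP := lie_jacobi x y z.
rewrite -addrA addr_eq0 opprD => /eqP ->.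
by rewrite addrC [lie z _]lieC opprK (lieC z x) lieNr opprK.
Qed.

Lemma lie_sumr (T : Type) (r : seq T) (w : T -> g) x :
  lie x (\sum_(i <- r) w i) = \sum_(i <- r) lie x (w i).
Proof. exact: (big_morph _ (lieDr x) (lie0r x)). Qed.

(** Applying ad(h) - mu_j to the relation removes the j-th term and rescales the others by nonzero
    factors, so induction applies. *)
Lemma ad_eigen_independent (T : eqType) (h : g) (mu : T -> F) (w : T -> g) r :
  uniq r -> {in r &, injective mu} ->
  (forall i, lie h (w i) = mu i *: w i) ->
  \sum_(i <- r) w i = 0 -> forall i, i \in r -> w i = 0.
Proof.
elim: r w => [//|j r IHr] w /= /andP[jr ur] mu_inj hw.
rewrite big_cons => w0.
have wr i : i \in r -> w i = 0.
  move=> ir; have muij : mu i - mu j != 0.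
    rewrite subr_eq0; apply: contraNneq jr => /mu_inj <-; rewrite ?inE ?eqxx //.
    by rewrite ir orbT.
  apply: (scalerI muij); rewrite scaler0.
  apply: (IHr (fun l => (mu l - mu j) *: w l)) => // [a b ar br|l|].
  - by apply: mu_inj; rewrite inE ?ar ?br orbT.
  - by rewrite lieZr hw !scalerA mulrC.
  - have := congr1 (lie h) w0; rewrite lieDr lie_sumr lie0r hw.
    move: w0 => /eqP; rewrite addr_eq0 => /eqP ->.
    rewrite scalerN scaler_sumr addrC -sumrB => e; rewrite -[RHS]e.
    by apply: eq_bigr => l _; rewrite hw scalerBl.
move=> i; rewrite inE => /predU1P[->|]; last exact: wr.
by move: w0; rewrite big_seq big1 ?addr0.
Qed.

End LieBasics.

(** * Weight vectors under a Cartan subalgebra *)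

Section WeightDecomposition.
Variables (R : realType) (g : lieAlgType R[i]) (H : {vspace g}).
Local Notation C := R[i].
Hypothesis H_cartan : cartan_subalgebra H.

Definition weight (beta : dual_of H) (x : g) : Prop :=
  forall h, h \in H -> lie h x = beta (vsproj H h) *: x.

Lemma weight_lie beta gamma x y :
  weight beta x -> weight gamma y -> weight (beta + gamma) (lie x y).
Proof.
move=> wx wy h hH.
by rewrite lie_derivation (wx h hH) (wy h hH) lieZl lieZr -scalerDl lfunE.
Qed.

Lemma weight_lin beta a x y :
  weight beta x -> weight beta y -> weight beta (a *: x + y).
Proof.
move=> wx wy h hH; rewrite lieDr lieZr (wx h hH) (wy h hH) scalerDr !scalerA.
by rewrite mulrC.
Qed.

Lemma weight_is_root beta x : beta != 0 -> x != 0 -> weight beta x ->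
  is_root beta.
Proof.
move=> beta0 x0 wx; split=> //; exists x => // h.
by rewrite wx ?subvsP // vsvalK.
Qed.

Lemma is_root_weight beta : is_root beta -> exists2 x, x != 0 & weight beta x.
Proof.
case=> _ [x x0 wx]; exists x => // h hH.
by rewrite -[in LHS](vsprojK hH) wx.
Qed.

Let H_lie h h' : h \in H -> h' \in H -> lie h h' = 0.
Proof. exact: (cartan_abelian H_cartan). Qed.

Lemma ad_commute h h' x : h \in H -> h' \in H ->
  lie h (lie h' x) = lie h' (lie h x).
Proof. by move=> hH h'H; rewrite lie_derivation (H_lie hH h'H) lie0l add0r. Qed.

(** Components are indexed by eigenvalues, so basis vectors with equal eigenvalue are merged; this
    gives the distinctness that [ad_eigen_independent] asks for. *)
Lemma ad_eigen_sum h x : h \in H -> exists (r : seq C) (w : C -> g),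
  [/\ uniq r, forall a, lie h (w a) = a *: w a & x = \sum_(a <- r) w a].
Proof.
move=> hH; have [e e_basis e_eigen] := cartan_diagonalizable H_cartan hH.
have : x \in <<e>>%VS by rewrite (span_basis e_basis) memvf.
elim: e e_eigen {e_basis} x => [|v e IHe] e_eigen x.
  rewrite span_nil memv0 => /eqP ->.
  by exists [::], (fun=> 0); split=> // [a|]; rewrite ?lie0r ?scaler0 ?big_nil.
rewrite span_cons => /memv_addP[_ /vlineP[b ->] [y ye ->] ].
have [u ue|r [w [ur hw ->] ] ] := IHe _ y ye.
  by apply: e_eigen; rewrite inE ue orbT.
have [c hv] := e_eigen v (mem_head v e).
have hb a : lie h (w a + (if a == c then b *: v else 0)) =
    a *: (w a + (if a == c then b *: v else 0)).
  rewrite lieDr hw scalerDr; congr (_ + _).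
  case: eqP => [->|_]; last by rewrite lie0r scaler0.
  by rewrite lieZr hv !scalerA mulrC.
have [cr|cr] := boolP (c \in r).
  exists r, (fun a => w a + (if a == c then b *: v else 0)); split=> //.
  rewrite big_split /= addrC; congr (_ + _).
  rewrite (bigD1_seq c) //= eqxx big1 ?addr0 // => a /negPf ->.
  by [].
exists (c :: r), (fun a => if a == c then b *: v else w a).
split=> [|a|]; first by rewrite /= cr.
  case: eqP => [->|_]; last exact: hw.
  by rewrite lieZr hv !scalerA mulrC.
rewrite big_cons eqxx; congr (_ + _); apply: eq_big_seq => a ar.
by case: eqP => // ac; rewrite ac (negPf cr) in ar.
Qed.

(** Serves as the weight space decomposition. Diagonalizing one basis element of H at a time reduces
    to joint eigenvectors, whose eigenvalues depend linearly on h. *)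
Lemma weight_ind (Q : g -> Prop) : Q 0 ->
  (forall x y, Q x -> Q y -> Q (x + y)) ->
  (forall beta x, x != 0 -> weight beta x -> Q x) -> forall x, Q x.
Proof.
move=> Q0 QD Qw.
pose joint (s : seq g) x := forall h, h \in s -> exists a : C, lie h x = a *: x.
have Qsum (r : seq C) w : (forall a, Q (w a)) -> Q (\sum_(a <- r) w a).
  by move=> Qa; elim/big_ind: _ => //.
have step s : {subset s <= H} ->
    (forall x, joint s x -> Q x) -> forall x, Q x.
  elim: s => [|h s IHs] sH Qs x; first exact: Qs.
  apply: IHs => [v vs|{}x jx]; first by apply: sH; rewrite inE vs orbT.
  have hH : h \in H by apply: sH; rewrite mem_head.
  have [r [w [ur hw xE] ] ] := ad_eigen_sum x hH.
  rewrite xE big_seq; elim/big_ind: _ => // a ar.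
  apply: Qs => h'; rewrite inE => /predU1P[->|h's]; first by exists a.
  have h'H : h' \in H by apply: sH; rewrite inE h's orbT.
  (* ad(h') - c commutes with ad(h) and kills x, so by independence it kills each ad(h)-component of
     x. *)
  have [c h'x] := jx _ h's; exists c; apply/eqP; rewrite -subr_eq0; apply/eqP.
  apply: (ad_eigen_independent (h := h) (mu := id)
            (w := fun a => lie h' (w a) - c *: w a) ur) => // [b|].
    rewrite lieDr lieNr ad_commute // hw !lieZr hw.
    by rewrite scalerBr scalerA mulrC scalerA.
  rewrite sumrB -lie_sumr -scaler_sumr -xE h'x subrr //.
apply: (step (vbasis H)) => [v|x jx]; first exact: vbasis_mem.
have [->|x0] := eqVneq x 0; first exact: Q0.
pose eig h : C := xget 0 [set a : C | lie h x = a *: x].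
have all_eig h : h \in H -> lie h x = eig h *: x.
  move=> hH; have [a ha] : exists a, lie h x = a *: x.
    rewrite (coord_vbasis hH).
    have : forall i : 'I_(\dim H), exists a, lie (vbasis H)`_i x = a *: x.
      by move=> i; apply: jx; rewrite mem_nth ?size_tuple.
    move=> /choice[a ha]; exists (\sum_i coord (vbasis H) i h * a i).
    rewrite lieC lie_sumr -sumrN scaler_suml; apply: eq_bigr => i _.
    by rewrite lieZr -scalerN -lieC ha scalerA.
  by rewrite /eig; case: xgetP => // /(_ a).
pose eigH (h : subvs_of H) : C^o := eig (vsval h).
have eig_lin : linear eigH.
  move=> a u v; apply/eqP.
  rewrite -subr_eq0 -[_ == 0]orbF -(negPf x0) -scaler_eq0.
  rewrite /eigH scalerBl subr_eq0 scalerDl -scalerA -!all_eig ?subvsP //.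
  by rewrite linearP lieDl lieZl.
pose L : {linear subvs_of H -> C^o} := HB.pack eigH
  (GRing.isLinear.Build C (subvs_of H) C^o *:%R eigH eig_lin).
apply: (Qw (linfun L)) => // h hH.
by rewrite lfunE /= /eigH vsprojK // all_eig.
Qed.

End WeightDecomposition.

(** * The invariant form and the geometry of roots *)

Section RootGeometry.
Variables (R : realType) (g : lieAlgType R[i]) (H : {vspace g}).
Variables (I : finType) (alpha : I -> dual_of H) (form : g -> g -> R[i]).
Local Notation C := R[i].
Hypothesis g_simple : simple_lie g.
Hypothesis H_cartan : cartan_subalgebra H.
Hypothesis alpha_simple : simple_roots alpha.
Hypothesis form_ip : invariant_inner_product alpha form.

Let formC x y : form x y = form y x. Proof. exact: (form_sym form_ip). Qed.

Let formDr x y z : form x (y + z) = form x y + form x z.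
Proof. by have := form_linear form_ip x 1 y z; rewrite !scale1r. Qed.

Let form0r x : form x 0 = 0.
Proof. by apply: (addrI (form x 0)); rewrite -formDr !addr0. Qed.

Let formZr a x y : form x (a *: y) = a * form x y.
Proof. by have := form_linear form_ip x a y 0; rewrite form0r !addr0. Qed.

Let formDl x y z : form (x + y) z = form x z + form y z.
Proof. by rewrite formC formDr !(formC z). Qed.

Let formZl a x y : form (a *: x) y = a * form x y.
Proof. by rewrite formC formZr (formC y). Qed.

Let form0l x : form 0 x = 0. Proof. by rewrite formC form0r. Qed.

Let form_inv x y z : form (lie x y) z = form x (lie y z).
Proof. exact: (form_invariant form_ip). Qed.

Lemma form_rep_spec lambda :
  form_rep form lambda = 0 \/
  form_rep form lambda \in H /\
  forall h : subvs_of H, form (form_rep form lambda) (vsval h) = lambda h.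
Proof. by rewrite /form_rep; case: xgetP => [x _ [xH xE]|_]; [right|left]. Qed.

(** If the representative were the default value 0 of [xget], the form would vanish at lambda,
    against positivity. *)
Lemma real_comb_rep (c : I -> R) : (exists i, c i != 0) ->
  let lambda := \sum_i ((c i)%:C)%C *: alpha i in
  form_rep form lambda \in H /\
  forall h : subvs_of H, form (form_rep form lambda) (vsval h) = lambda h.
Proof.
move=> c0 lambda; have [t0|//] := form_rep_spec lambda.
have := form_positive form_ip c0.
by rewrite /dual_form -/lambda t0 form0l ltxx.
Qed.

(** Not rescaled by 2/(alpha_i, alpha_i): here alpha_i(t_i) = (alpha_i, alpha_i). *)
Definition coroot (i : I) : g := form_rep form (alpha i).
Local Notation t := coroot.
Local Notation ip i j := (dual_form form (alpha i) (alpha j)).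

Let delta_comb i : \sum_j ((((j == i)%:R : R))%:C)%C *: alpha j = alpha i.
Proof.
rewrite (bigD1 i) //= eqxx scale1r big1 ?addr0 // => j /negPf ->.
by rewrite scale0r.
Qed.

Lemma coroot_spec i : t i \in H /\
  forall h : subvs_of H, form (t i) (vsval h) = alpha i h.
Proof.
have := @real_comb_rep (fun j => (j == i)%:R); rewrite delta_comb; apply.
by exists i; rewrite eqxx oner_eq0.
Qed.

Lemma corootH i : t i \in H. Proof. by case: (coroot_spec i). Qed.

Lemma form_coroot i h : h \in H -> form (t i) h = alpha i (vsproj H h).
Proof. by move=> hH; rewrite -{1}(vsprojK hH); case: (coroot_spec i). Qed.

Lemma root_coroot i j : alpha i (vsproj H (t j)) = ip i j.
Proof. by rewrite -form_coroot ?corootH. Qed.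

Lemma ip_sym i j : ip i j = ip j i.
Proof. exact: formC. Qed.

Lemma ip_gt0 i : 0 < ip i i.
Proof.
have := form_positive form_ip (c := fun j => (j == i)%:R).
by rewrite /= delta_comb; apply; exists i; rewrite eqxx oner_eq0.
Qed.

(** Orthogonality to every t_i puts x in the kernel of every alpha_i, and these span the dual of
    H. *)
Lemma form_H_nondegenerate x : x \in H ->
  (forall h, h \in H -> form x h = 0) -> x = 0.
Proof.
move=> xH x0; pose u := vsproj H x.
have au i : alpha i u = 0 by rewrite -form_coroot // formC x0 ?corootH.
have all_u (lambda : dual_of H) : lambda u = 0.
  have : lambda \in <<[seq alpha i | i : I]>>%VS.
    by rewrite (span_basis (simple_basis alpha_simple)) memvf.
  move/coord_span => ->; rewrite sum_lfunE big1 // => k _.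
  rewrite scale_lfunE.
  have /mapP[i _ ->] : [seq alpha i | i : I]`_k \in [seq alpha i | i : I].
    by rewrite mem_nth // size_image ltn_ord.
  by rewrite au scaler0.
have u0 : u = 0.
  rewrite (coord_vbasis (memvf u)) big1 // => k _.
  have := all_u (linfun (coord (vbasis fullv) k : {linear _ -> C^o})).
  by rewrite lfunE /= => ->; rewrite scale0r.
by rewrite -(vsprojK xH) -/u u0 linear0.
Qed.

Lemma coroot_rep x (c : I -> C) : x \in H ->
  (forall h : subvs_of H, form x (vsval h) = (\sum_i c i *: alpha i) h) ->
  x = \sum_i c i *: t i.
Proof.
move=> xH xE; apply/eqP; rewrite -subr_eq0; apply/eqP.
have sumH : \sum_i c i *: t i \in H.
  by apply: rpred_sum => i _; rewrite rpredZ ?corootH.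
apply: form_H_nondegenerate; first by rewrite rpredB.
move=> h hH; rewrite -scaleN1r formDl formZl mulN1r.
have -> : form (\sum_i c i *: t i) h = \sum_i c i * form (t i) h.
  rewrite (big_morph (form^~ h) (fun x y => formDl x y h) (form0l h)).
  by apply: eq_bigr => i _; rewrite formZl.
rewrite -{1}(vsprojK hH) xE sum_lfunE; apply/eqP; rewrite subr_eq0; apply/eqP.
by apply: eq_bigr => i _; rewrite scale_lfunE form_coroot.
Qed.

Lemma real_comb_gt0 (c : I -> R) : (exists i, c i != 0) ->
  0 < \sum_i \sum_j ((c i)%:C)%C * ((c j)%:C)%C * ip i j.
Proof.
move=> c0; have := form_positive form_ip c0.
have [tH tE] := real_comb_rep c0.
rewrite /dual_form (coroot_rep tH tE).
rewrite (big_morph (form^~ _) (fun x y => formDl x y _) (form0l _)).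
congr (0 < _); apply: eq_bigr => i _.
rewrite formZl (big_morph (form _) (formDr _) (form0r _)) mulr_sumr.
by apply: eq_bigr => j _; rewrite formZr mulrA.
Qed.

Lemma alpha_real_free (c : I -> R) :
  \sum_i ((c i)%:C)%C *: alpha i = 0 -> forall i, c i = 0.
Proof.
move=> c0 i; apply/eqP/negPn/negP => ci0.
have ex_c : exists i, c i != 0 by exists i.
have [tH tE] := real_comb_rep ex_c; rewrite c0 in tH tE.
have t0 : form_rep form (0 : dual_of H) = 0.
  apply: form_H_nondegenerate => // h hH.
  by rewrite -(vsprojK hH) tE zero_lfunE.
by have := form_positive form_ip ex_c; rewrite c0 /dual_form t0 form0l ltxx.
Qed.

Let sum_pair (V : zmodType) i j (G : I -> V) : i != j ->
  (forall k, k != i -> k != j -> G k = 0) -> \sum_k G k = G i + G j.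
Proof.
move=> ij G0; rewrite (bigD1 i) //= (bigD1 j) 1?eq_sym //=; congr (_ + _).
by rewrite big1 ?addr0 // => k /andP[ki kj]; exact: G0.
Qed.

Lemma ip_pair_gt0 i j (x y : R) : i != j -> x != 0 ->
  0 < x%:C%C ^+ 2 * ip i i + 2 * x%:C%C * y%:C%C * ip i j
      + y%:C%C ^+ 2 * ip j j.
Proof.
move=> ij x0; pose c k : R := if k == i then x else if k == j then y else 0.
have ci : c i = x by rewrite /c eqxx.
have cj : c j = y by rewrite /c eq_sym (negPf ij) eqxx.
have c0 k : k != i -> k != j -> c k = 0 by rewrite /c => /negPf -> /negPf ->.
have := @real_comb_gt0 c; rewrite (sum_pair ij) => [|k ki kj]; last first.
  by rewrite big1 // => l _; rewrite c0 // !mul0r.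
rewrite !(sum_pair ij) => [|k ki kj|k ki kj];
  rewrite ?(c0 k) ?rmorph0 ?mulr0 ?mul0r //.
rewrite ci cj (ip_sym j i) => c_gt0; have : exists k, c k != 0.
  by exists i; rewrite ci.
by move/c_gt0; congr (0 < _); ring.
Qed.

(** Strict Cauchy-Schwarz. That (alpha_i, alpha_j) is real comes from the positive value of the form
    at alpha_i + alpha_j. *)
Lemma ip_det i j : i != j -> ip i i * ip j j != ip i j ^+ 2.
Proof.
move=> ij; have real_ip k : ip k k \is Num.real by rewrite gtr0_real ?ip_gt0.
have real_ij : ip i j \is Num.real.
  have := gtr0_real (ip_pair_gt0 1 ij (oner_neq0 R)).
  set S := (X in X \is _) => S_real.
  have -> : ip i j = (S - ip i i - ip j j) / 2 by rewrite /S; field.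
  by rewrite realM ?realB // realV realn.
have [a0|a0] := eqVneq (ip i j) 0.
  by rewrite a0 expr0n mulf_neq0 ?gt_eqF ?ip_gt0.
(* At x = (alpha_i, alpha_j), y = -(alpha_i, alpha_i) the quadratic form equals (alpha_i, alpha_i)
   times the determinant. *)
have := @ip_pair_gt0 i j (complex.Re (ip i j)) (- complex.Re (ip i i)) ij.
rewrite rmorphN /= !RRe_real // => gt0.
have /gt0 {}gt0 : complex.Re (ip i j) != 0.
  by apply: contraNneq a0 => a0; rewrite -(RRe_real real_ij) a0.
apply: contraTneq gt0 => det0.
rewrite -det0 (_ : _ + _ = 0) ?ltxx //.
have -> : 2 * ip i j * - ip i i * ip i j = - 2 * ip i i * (ip i j ^+ 2).
  by ring.
by rewrite -det0; ring.
Qed.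

(** The radical is an ideal by invariance and misses t_i, so simplicity makes it zero. *)
Lemma form_nondegenerate (i : I) x : (forall y, form x y = 0) -> x = 0.
Proof.
move=> x0; pose P x := forall y, form x y = 0.
have [U UP] : exists U : {vspace g}, forall x, x \in U <-> P x.
  apply: vspace_of_pred => [y|a u v Pu Pv y]; first exact: form0l.
  by rewrite formDl formZl Pu Pv mulr0 addr0.
have U_ideal : lie_ideal U.
  move=> u v /UP Pv; apply/UP => y.
  by rewrite lieC -scaleN1r formZl form_inv Pv mulr0.
have [U0|Ufull] := (proj2 g_simple) U U_ideal.
  by apply/eqP; rewrite -memv0 -U0; apply/UP.
have /UP/(_ (t i)) : t i \in U by rewrite Ufull memvf.
by move/eqP; rewrite (gt_eqF (ip_gt0 i)).
Qed.

(** Some weight vector pairs nontrivially with z, and invariance forces its weight to be -beta. *)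
Lemma opposite_weight (i : I) (beta : dual_of H) z : z != 0 -> weight beta z ->
  exists2 z', weight (- beta) z' & form z z' != 0.
Proof.
move=> z0 wz.
have [y zy0] : exists y, form z y != 0.
  apply: contrapT => no_y; move/eqP: z0; apply.
  apply: (form_nondegenerate i) => y.
  by apply/eqP/negPn/negP => zy; apply: no_y; exists y.
elim/(weight_ind H_cartan): y zy0 => [|u v IHu IHv|gamma u u0 wu].
- by rewrite form0r eqxx.
- rewrite formDr => uv; have [zu|zu] := eqVneq (form z u) 0; last exact: IHu.
  by apply: IHv; rewrite zu add0r in uv.
move=> zu; exists u => //.
suff <- : gamma = - beta by [].
apply/lfunP => h; rewrite opp_lfunE; apply: (mulIf zu).
have := form_inv z (vsval h) u; rewrite (wu _ (subvsP h)) formZr.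
rewrite lieC (wz _ (subvsP h)) -scaleN1r !formZl mulrA mulN1r !vsvalK.
by move=> <-; rewrite mulNr.
Qed.

(** The bracket centralizes H, hence lies in H by maximality; invariance computes its pairing with
    each h in H. *)
Lemma opposite_bracket i e f : weight (alpha i) e -> weight (- alpha i) f ->
  lie e f = form e f *: t i.
Proof.
move=> we wf.
have efH : lie e f \in H.
  apply: (cartan_maximal H_cartan) => h hH.
  by have := weight_lie we wf hH; rewrite subrr zero_lfunE scale0r.
apply/eqP; rewrite -subr_eq0; apply/eqP.
apply: form_H_nondegenerate => [|h hH].
  by rewrite rpredB ?rpredZ ?corootH.
rewrite -scaleN1r formDl !formZl form_coroot // form_inv lieC (wf h hH).
by rewrite opp_lfunE scaleNr opprK formZr mulrC mulN1r subrr.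
Qed.

(** * Root strings *)

Lemma weight_iter (beta gamma : dual_of H) x y k :
  weight beta x -> weight gamma y ->
  weight (gamma + beta *+ k) (iter k (lie x) y).
Proof.
move=> wx wy; elim: k => [|k IHk]; first by rewrite addr0.
by rewrite iterS mulrS addrCA; exact: weight_lie.
Qed.

Lemma raising_vanishes i e (beta : dual_of H) z :
  weight (alpha i) e -> weight beta z ->
  exists m, iter m (lie e) z = 0.
Proof.
move=> we wz; apply: contrapT => never0.
have all_neq0 m : iter m (lie e) z != 0.
  by apply/negP => /eqP m0; apply: never0; exists m.
pose n := (\dim {:g}).+1; pose X := [tuple iter m (lie e) z | m < n].
have Xi (m : 'I_n) : X`_m = iter m (lie e) z by rewrite -tnth_nth tnth_mktuple.
suff freeX : free X.
  have := dimvS (subvf <<X>>%VS); rewrite (eqP freeX) size_tuple.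
  by rewrite ltnn.
apply/freeP => k sumX m.
have ii := ip_gt0 i.
have : k m *: X`_m = 0.
  apply: (ad_eigen_independent (h := t i) (r := enum 'I_n)
    (mu := fun m : 'I_n => beta (vsproj H (t i)) + ip i i *+ m)
    (w := fun m : 'I_n => k m *: X`_m)).
  - exact: enum_uniq.
  - move=> a b _ _ /addrI/eqP; rewrite -subr_eq0 => eq_ab.
    apply/val_inj/eqP; move: eq_ab.
    rewrite -[_ *+ a]mulr_natr -[_ *+ b]mulr_natr.
    by rewrite -mulrBr mulf_eq0 (gt_eqF ii) /= subr_eq0 eqr_nat.
  - move=> a; rewrite lieZr Xi (weight_iter a we wz (corootH i)).
    rewrite add_lfunE scalerA mulrC -scalerA; congr (_ *: _).
    by rewrite -[alpha i *+ a]scaler_nat scale_lfunE root_coroot scaler_nat.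
  - by rewrite big_enum /= sumX.
  - exact: mem_enum.
move/eqP; rewrite scaler_eq0 Xi (negPf (all_neq0 m)) orbF => /eqP //.
Qed.

Lemma highest_vector i e (beta : dual_of H) z :
  weight (alpha i) e -> weight beta z -> z != 0 -> exists m v,
    [/\ v != 0, weight (beta + alpha i *+ m) v & lie e v = 0].
Proof.
move=> we wz z0.
have : exists m, iter m (lie e) z == 0.
  by have [m m0] := raising_vanishes we wz; exists m; rewrite m0.
case/ex_minnP=> -[|m] /eqP m0 min_m; first by case/eqP: z0.
exists m, (iter m (lie e) z); split=> //; last exact: weight_iter.
by apply/negP => /min_m; rewrite ltnn.
Qed.

(** The sl_2 computation, normalized by [e, f] = t_i: the scalar is the sum of the t_i-eigenvalues
    of v, ..., f^k v. *)
Lemma raise_lowered i e f (mu : dual_of H) v k :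
  weight (- alpha i) f -> lie e f = t i -> weight mu v -> lie e v = 0 ->
  lie e (iter k.+1 (lie f) v) =
  (k.+1%:R * (mu (vsproj H (t i)) - k%:R / 2 * ip i i)) *: iter k (lie f) v.
Proof.
move=> wf ef wv ev; elim: k => [|k IHk].
  rewrite /= lie_derivation ef ev lie0r addr0 (wv _ (corootH i)).
  by rewrite mul1r !mul0r subr0.
rewrite iterS lie_derivation ef IHk lieZr -iterS.
rewrite (weight_iter k.+1 wf wv (corootH i)) -scalerDl; congr (_ *: _).
rewrite add_lfunE mulNrn opp_lfunE -scaler_nat scale_lfunE root_coroot.
rewrite -[k.+2%:R]natr1 -[k.+1%:R]natr1.
have -> : (k%:R + 1 : C) *: (ip i i : C^o) = (k%:R + 1) * ip i i by [].
by field.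
Qed.

(** * Signs of root coordinates and connectedness of the Dynkin diagram *)

Definition real_comb (c : I -> R) : dual_of H :=
  \sum_k ((c k)%:C)%C *: alpha k.

Lemma real_combB c d :
  real_comb c - real_comb d = real_comb (fun k => c k - d k).
Proof.
rewrite /real_comb -sumrB; apply: eq_bigr => k _.
by rewrite -scalerBl rmorphB.
Qed.

Lemma real_combN c : - real_comb c = real_comb (fun k => - c k).
Proof.
rewrite /real_comb -sumrN; apply: eq_bigr => k _.
by rewrite -scaleNr rmorphN.
Qed.

Lemma real_combMn c m : real_comb c *+ m = real_comb (fun k => c k *+ m).
Proof.
rewrite /real_comb -sumrMnl; apply: eq_bigr => k _.
by rewrite rmorphMn /= scalerMnl.
Qed.

Lemma real_combD c d :
  real_comb c + real_comb d = real_comb (fun k => c k + d k).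
Proof.
rewrite /real_comb -big_split; apply: eq_bigr => k _ /=.
by rewrite -scalerDl rmorphD.
Qed.

Lemma real_comb_inj c d : real_comb c = real_comb d -> c =1 d.
Proof.
move=> cd k; apply/eqP; rewrite -subr_eq0; apply/eqP.
apply: (alpha_real_free (c := fun k => c k - d k)).
by rewrite -[LHS]real_combB cd subrr.
Qed.

Lemma real_comb_nat (n : I -> nat) :
  \sum_k alpha k *+ n k = real_comb (fun k => (n k)%:R).
Proof. by apply: eq_bigr => k _; rewrite rmorph_nat scaler_nat. Qed.

Lemma root_sign c : is_root (real_comb c) ->
  (forall k, 0 <= c k) \/ (forall k, c k <= 0).
Proof.
case/(simple_sign alpha_simple)=> n; rewrite real_comb_nat real_combN.
by case=> /real_comb_inj cE; [left|right] => k; rewrite cE ?oppr_le0 ler0n.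
Qed.

Lemma real_comb_coroot c i : (forall l, l != i -> ip i l = 0) ->
  real_comb c (vsproj H (t i)) = ((c i)%:C)%C * ip i i.
Proof.
move=> iso; rewrite /real_comb sum_lfunE (bigD1 i) //= big1 => [|l li].
  by rewrite addr0 scale_lfunE root_coroot.
by rewrite scale_lfunE root_coroot ip_sym iso // scaler0.
Qed.

(* If alpha_i is orthogonal to the other simple roots, then a root with positive
   alpha_i-coordinate n has alpha_i-string long enough to be lowered n + 1
   times, which makes that coordinate -1 and so excludes positive ones. *)
Lemma isolated_root_support i c z : (forall l, l != i -> ip i l = 0) ->
  z != 0 -> weight (real_comb c) z -> forall m : nat, c i = m.+1%:R ->
  forall l, l != i -> 0 < c l -> False.
Proof.
move=> iso z0 wz m cm l li cl.
have [e e0 we] := is_root_weight (simple_root alpha_simple i).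
have [f' wf' ef'] := opposite_weight i e0 we.
pose f := (form e f')^-1 *: f'.
have wf : weight (- alpha i) f.
  by rewrite -[f]addr0; apply: weight_lin => // h _; rewrite lie0r scaler0.
have ef : lie e f = t i.
  by rewrite (opposite_bracket we wf) /f formZr mulVf ?scale1r.
have [M [v [v0 wv ev] ] ] := highest_vector we wz z0.
pose N := (m.+1 + M)%N.
have ai : alpha i = real_comb (fun k => (k == i)%:R).
  by rewrite /real_comb delta_comb.
rewrite ai real_combMn real_combD in wv.
have fv0 k : (k <= N.+1)%N -> iter k (lie f) v != 0.
  elim: k => [//|k IHk] kN; apply: contraNneq (IHk (ltnW kN)) => fk0.
  (* If the next iterate were zero, the scalar for k would vanish, forcing k = 2N; but k <= N and N
     > 0. *)
  have /eqP := raise_lowered k wf ef wv ev.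
  rewrite fk0 lie0r eq_sym scaler_eq0 real_comb_coroot // eqxx cm -mulrBl.
  rewrite !mulf_eq0 (gt_eqF (ip_gt0 i)) orbF pnatr_eq0 /= => /orP[|//].
  rewrite -natrD rmorph_nat -/N subr_eq0 => /eqP eqN.
  have : (2 * N)%:R = k%:R :> C by rewrite natrM eqN mulrC divfK // pnatr_eq0.
  by move/eqP; rewrite eqr_nat => /eqP; lia.
have wf2 := weight_iter N.+1 wf wv.
rewrite ai real_combN real_combMn real_combD in wf2.
(* The lowered weight has alpha_i-coordinate -1 and keeps its positive alpha_l-coordinate, so its
   signs are mixed. *)
move: wf2; set d := (fun k => _) => wd.
have di : d i = -1.
  rewrite /d eqxx cm mulNrn -natrD -/N -[N.+1%:R]natr1 opprD addrA subrr.
  exact: add0r.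
have dl : d l = c l by rewrite /d (negPf li) mul0rn addr0 oppr0 mul0rn addr0.
have d_root : is_root (real_comb d).
  apply: weight_is_root (fv0 _ (leqnn _)) wd.
  apply/eqP => /alpha_real_free/(_ i)/eqP; rewrite di.
  by rewrite oppr_eq0 oner_eq0.
case: (root_sign d_root) => [/(_ i)|/(_ l)].
  by rewrite di oppr_ge0 ler10.
by rewrite dl leNgt cl.
Qed.

(* The centralizer of the t_i-eigenvectors with nonzero eigenvalue is an ideal;
   it never contains t_i, and it contains t_j if i is isolated. *)
Lemma not_isolated i j : i != j -> exists2 l, i != l & ip i l != 0.
Proof.
move=> ij; apply: contrapT => no_l.
have iso l : l != i -> ip i l = 0.
  move=> li; apply/eqP/negPn/negP => il; apply: no_l; exists l => //.
  by rewrite eq_sym.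
have tj_weight beta z : weight beta z -> beta (vsproj H (t i)) != 0 ->
    lie z (t j) = 0.
  move=> wz beta_i; have [->|z0] := eqVneq z 0; first exact: lie0l.
  have beta0 : beta != 0.
    by apply: contraNneq beta_i => ->; rewrite zero_lfunE.
  (* A positive alpha_i-coordinate excludes other positive coordinates, so the weight is a multiple
     of alpha_i, which vanishes at t_j. *)
  have beta_j n x : x != 0 -> weight (real_comb (fun k => (n k)%:R)) x ->
      ((n i)%:R : C) != 0 -> real_comb (fun k => (n k)%:R) (vsproj H (t j)) = 0.
    move=> x0 wx; rewrite pnatr_eq0 => ni.
    rewrite /real_comb sum_lfunE big1 // => l _.
    rewrite scale_lfunE root_coroot; have [->|li] := eqVneq l i.
      by rewrite iso ?scaler0 // eq_sym.
    have [->|nl] := posnP (n l); first by rewrite rmorph0 scale0r.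
    case: (isolated_root_support iso x0 wx (m := (n i).-1) _ li).
      by rewrite prednK // lt0n.
    by rewrite ltr0n.
  rewrite lieC (wz _ (corootH j)).
  have [n] := simple_sign alpha_simple (weight_is_root beta0 z0 wz).
  rewrite real_comb_nat => -[] betaE; rewrite betaE in wz beta_i *.
    rewrite (beta_j n z) ?scale0r ?oppr0 //.
    apply: contraNneq beta_i => ni.
    by rewrite real_comb_coroot // rmorph_nat ni mul0r.
  (* A negative weight is treated through a vector of the opposite weight. *)
  have [z' wz' zz'] := opposite_weight i z0 wz.
  rewrite opprK in wz'.
  rewrite opp_lfunE (beta_j n z') ?oppr0 ?scale0r ?oppr0 //.
    by apply: contraNneq zz' => ->; rewrite form0r.
  apply: contraNneq beta_i => ni.
  by rewrite opp_lfunE real_comb_coroot // rmorph_nat ni mul0r oppr0.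
pose P x := forall beta z, weight beta z -> beta (vsproj H (t i)) != 0 ->
  lie z x = 0.
have [N NP] : exists N : {vspace g}, forall x, x \in N <-> P x.
  apply: vspace_of_pred => [beta z _ _|a x y Px Py beta z wz bi].
    exact: lie0r.
  by rewrite lieDr lieZr (Px _ _ wz bi) (Py _ _ wz bi) scaler0 addr0.
have N_ideal : lie_ideal N.
  move=> y x /NP Px; apply/NP => beta z wz bi.
  elim/(weight_ind H_cartan): y => [|u v IHu IHv|gamma u _ wu].
  - by rewrite lie0l lie0r.
  - by rewrite lieDl lieDr IHu IHv addr0.
  rewrite lie_derivation (Px _ _ wz bi) lie0r addr0.
  (* If beta + gamma vanishes at t_i then gamma does not, so x commutes with u as well as with z. *)
  have [bg|bg] := eqVneq ((beta + gamma) (vsproj H (t i))) 0; last first.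
    exact: Px (weight_lie wz wu) bg.
  have gi : gamma (vsproj H (t i)) != 0.
    apply: contraNneq bi => gi; move: bg; rewrite add_lfunE gi addr0 => ->.
    by [].
  have := lie_derivation z u x.
  rewrite (Px _ _ wu gi) (Px _ _ wz bi) !lie0r addr0.
  by move=> <-.
have [N0|Nfull] := (proj2 g_simple) N N_ideal.
  have /NP : P (t j) by move=> beta z; exact: tj_weight.
  rewrite N0 memv0 => /eqP tj0.
  by have := ip_gt0 j; rewrite /dual_form -/(t j) tj0 form0l ltxx.
have [e e0 we] := is_root_weight (simple_root alpha_simple i).
have /NP/(_ _ _ we) : t i \in N by rewrite Nfull memvf.
rewrite root_coroot (gt_eqF (ip_gt0 i)) => /(_ isT)/eqP.
rewrite lieC (we _ (corootH i)) root_coroot oppr_eq0 scaler_eq0.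
by rewrite (gt_eqF (ip_gt0 i)) (negPf e0).
Qed.

End RootGeometry.

(** * Universal property of presented algebras *)

Section FreeLift.
Variables (K : comNzRingType) (X : choiceType) (B : algType K) (f : X -> B).

Definition word_eval (m : fmonom X) : B := \prod_(x <- m) f x.

Fact word_eval_is_mmorphism : mmorphism word_eval.
Proof.
by split=> [m n|]; rewrite /word_eval ?fmM ?big_cat // fm1 big_nil.
Qed.
HB.instance Definition _ :=
  isMultiplicative.Build (fmonom X) B word_eval word_eval_is_mmorphism.

Definition free_lift (u : free_alg K X) : B := mmap (in_alg B) word_eval u.

Fact free_lift_is_additive : zmod_morphism free_lift.
Proof. exact: mmapB. Qed.
HB.instance Definition _ :=
  GRing.isZmodMorphism.Build (free_alg K X) B free_lift free_lift_is_additive.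

Fact free_lift_is_multiplicative : monoid_morphism free_lift.
Proof.
have comm_in_alg (g : {malg K[fmonom X]}) (m m' : fmonom X) :
  GRing.comm (in_alg B g@_m) (word_eval m').
  by rewrite /GRing.comm /= mulr_algl mulr_algr.
have [hM h1] := commr_mmap_is_multiplicative comm_in_alg.
by split; [exact: h1|exact: hM].
Qed.
HB.instance Definition _ :=
  GRing.isMonoidMorphism.Build (free_alg K X) B free_lift
    free_lift_is_multiplicative.

Fact free_lift_is_scalable : scalable free_lift.
Proof.
by move=> c u; rewrite /free_lift mmapZ /= mulr_algl.
Qed.
HB.instance Definition _ :=
  GRing.isScalable.Build K (free_alg K X) B *:%R free_lift
    free_lift_is_scalable.

Lemma free_lift_gen x : free_lift (free_gen K x) = f x.
Proof.
by rewrite /free_lift mmapU /= /word_eval fmU big_seq1 scale1r mul1r.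
Qed.

End FreeLift.

Lemma free_alg_ext (K : comNzRingType) (X : choiceType) (B : algType K)
    (p q : {lrmorphism free_alg K X -> B}) :
  (forall x, p (free_gen K x) = q (free_gen K x)) -> p =1 q.
Proof.
move=> pq u.
have word m : p << m >> = q << m >>.
  case: m => s; elim: s => [|x s IHs].
    have -> : << FMonom [::] >> = 1 :> free_alg K X.
      by congr (<< _ >>); apply/eqP; rewrite -val_eqE /= fm1.
    by rewrite !rmorph1.
  have -> : << FMonom (x :: s) >> =
      free_gen K x * << FMonom s >> :> free_alg K X.
    rewrite [RHS]fgmulUU mulr1; congr (<< _ >>).
    by apply/eqP; rewrite -val_eqE /= fmM fmU.
  by rewrite !rmorphM /= pq IHs.
have -> : u = \sum_(m <- msupp (u : {malg K[fmonom X]}))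
    (u : {malg K[fmonom X]})@_m *: (<< m >> : free_alg K X).
  rewrite [LHS]monalgE; apply: eq_bigr => m _.
  by apply/malgP => l; rewrite mcoeffZ !mcoeffU mulrnAr mulr1.
by rewrite !linear_sum; apply: eq_bigr => m _; rewrite !linearZ /= word.
Qed.

(** * Homomorphisms out of a presented algebra *)

Section PresentedLift.
Variables (K : comNzRingType) (X : choiceType).
Variables (E : free_alg K X -> free_alg K X -> Prop).
Hypothesis E_aug : forall x y, E x y -> free_aug x = free_aug y.
Local Notation P := (presented_alg E_aug).
Local Notation pi := (alg_pi (proper_relation_ideal E_aug)).

Lemma presented_rel x y : E x y -> pi x = pi y.
Proof. by move=> Exy; apply: alg_pi_eq; exact: Relation_ideal_gen. Qed.

Section Lift.
Variables (B : algType K) (f : X -> B).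

(** The compatibility proof is an argument so that the morphism structures can be declared on this
    map. *)
Definition presented_lift
    of forall x y, E x y -> free_lift f x = free_lift f y :=
  fun u : P => free_lift f (repr u).

Hypothesis f_rel : forall x y, E x y -> free_lift f x = free_lift f y.
Local Notation lift := (presented_lift f_rel).

Lemma presented_lift_pi x : lift (pi x) = free_lift f x.
Proof.
apply/eqP; rewrite -subr_eq0 -rmorphB /=.
suff H y : relation_ideal E y -> free_lift f y = 0.
  by apply/eqP/H; exact: (alg_repr_pi (proper_relation_ideal E_aug) x).
elim=> {y} [y z /f_rel yz||y z _ y0 _ z0|a y _ y0|a y _ y0].
- by rewrite rmorphB /= yz subrr.
- exact: rmorph0.
- by rewrite rmorphD /= y0 z0 addr0.
- by rewrite rmorphM /= y0 mulr0.
- by rewrite rmorphM /= y0 mul0r.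
Qed.

Fact presented_lift_is_additive : zmod_morphism lift.
Proof.
elim/alg_quotW=> x; elim/alg_quotW=> y.
by rewrite -rmorphB !presented_lift_pi rmorphB.
Qed.
HB.instance Definition _ :=
  GRing.isZmodMorphism.Build P B lift presented_lift_is_additive.

Fact presented_lift_is_multiplicative : monoid_morphism lift.
Proof.
split=> [|]; first by rewrite -(rmorph1 pi) presented_lift_pi rmorph1.
elim/alg_quotW=> x; elim/alg_quotW=> y.
by rewrite -rmorphM !presented_lift_pi rmorphM.
Qed.
HB.instance Definition _ :=
  GRing.isMonoidMorphism.Build P B lift
    presented_lift_is_multiplicative.

Fact presented_lift_is_scalable : scalable lift.
Proof.
move=> c; elim/alg_quotW=> x.
by rewrite -linearZ /= !presented_lift_pi linearZ.
Qed.
HB.instance Definition _ :=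
  GRing.isScalable.Build K P B *:%R lift presented_lift_is_scalable.

Lemma presented_lift_gen x : lift (presented_gen E_aug x) = f x.
Proof. by rewrite presented_lift_pi free_lift_gen. Qed.

End Lift.

Lemma presented_alg_ext (B : algType K) (p q : {lrmorphism P -> B}) :
  (forall x, p (presented_gen E_aug x) = q (presented_gen E_aug x)) -> p =1 q.
Proof.
move=> pq; elim/alg_quotW=> x.
exact: (free_alg_ext (p := p \o pi) (q := q \o pi)).
Qed.

End PresentedLift.

(** * Deciding identities in noncommutative polynomials *)

Section NoncommutativePolynomials.
Variables (K : comNzRingType) (A : algType K).

Inductive ncexpr :=
| NCvar of nat | NCone | NCzero | NCopp of ncexpr
| NCadd of ncexpr & ncexpr | NCmul of ncexpr & ncexpr | NCscale of K & ncexpr.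

Fixpoint nc_eval (env : seq A) (e : ncexpr) : A :=
  match e with
  | NCvar n => nth 0 env n
  | NCone => 1
  | NCzero => 0
  | NCopp e => - nc_eval env e
  | NCadd e1 e2 => nc_eval env e1 + nc_eval env e2
  | NCmul e1 e2 => nc_eval env e1 * nc_eval env e2
  | NCscale c e => c *: nc_eval env e
  end.

Definition nc_poly := seq (seq nat * K).

Definition nc_word (env : seq A) (w : seq nat) : A :=
  foldr (fun n x => nth 0 env n * x) 1 w.

Definition nc_poly_eval (env : seq A) (p : nc_poly) : A :=
  foldr (fun t x => t.2 *: nc_word env t.1 + x) 0 p.

Fixpoint same_word (v w : seq nat) : bool :=
  match v, w with
  | [::], [::] => true
  | m :: v', n :: w' => eqn m n && same_word v' w'
  | _, _ => false
  end.

Lemma same_wordP v w : reflect (v = w) (same_word v w).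
Proof.
suff -> : same_word v w = (v == w) by exact: eqP.
by elim: v w => [|m v IHv] [|n w] //=; rewrite IHv.
Qed.

Fixpoint nc_insert (w : seq nat) (c : K) (p : nc_poly) : nc_poly :=
  match p with
  | [::] => [:: (w, c)]
  | t :: p' => if same_word w t.1 then (t.1, c + t.2) :: p'
               else t :: nc_insert w c p'
  end.

Definition nc_add (p q : nc_poly) : nc_poly :=
  foldr (fun t r => nc_insert t.1 t.2 r) q p.

Definition nc_scale (c : K) (p : nc_poly) : nc_poly :=
  map (fun t => (t.1, c * t.2)) p.

Definition nc_mul (p q : nc_poly) : nc_poly :=
  foldr (fun t r => nc_add (map (fun u => (t.1 ++ u.1, t.2 * u.2)) q) r) [::] p.

Fixpoint nc_norm (e : ncexpr) : nc_poly :=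
  match e with
  | NCvar n => [:: ([:: n], 1)]
  | NCone => [:: ([::], 1)]
  | NCzero => [::]
  | NCopp e => nc_scale (-1) (nc_norm e)
  | NCadd e1 e2 => nc_add (nc_norm e1) (nc_norm e2)
  | NCmul e1 e2 => nc_mul (nc_norm e1) (nc_norm e2)
  | NCscale c e => nc_scale c (nc_norm e)
  end.

(** Equations in K rather than a boolean test: the coefficients are symbolic, and each equation is
    left to [ring]. *)
Definition nc_vanishes (p : nc_poly) : Prop :=
  foldr (fun t P => t.2 = 0 /\ P) True p.

Lemma nc_insertE env w c p :
  nc_poly_eval env (nc_insert w c p) = c *: nc_word env w + nc_poly_eval env p.
Proof.
elim: p => [//|[w' c'] p IHp] /=.
case: same_wordP => [<-|_] /=; last by rewrite IHp addrCA.
by rewrite scalerDl addrA.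
Qed.

Lemma nc_addE env p q :
  nc_poly_eval env (nc_add p q) = nc_poly_eval env p + nc_poly_eval env q.
Proof.
by elim: p => [|t p IHp] /=; rewrite ?add0r // nc_insertE IHp addrA.
Qed.

Lemma nc_scaleE env c p :
  nc_poly_eval env (nc_scale c p) = c *: nc_poly_eval env p.
Proof.
by elim: p => [|t p IHp] /=; rewrite ?scaler0 // IHp scalerDr scalerA.
Qed.

Lemma nc_wordM env v w :
  nc_word env (v ++ w) = nc_word env v * nc_word env w.
Proof. by elim: v => [|n v IHv] /=; rewrite ?mul1r // IHv mulrA. Qed.

Lemma nc_mulE env p q :
  nc_poly_eval env (nc_mul p q) = nc_poly_eval env p * nc_poly_eval env q.
Proof.
elim: p => [|[v c] p IHp] /=; rewrite ?mul0r // nc_addE IHp mulrDl.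
congr (_ + _); elim: q {IHp} => [|[w e] q IHq] /=; rewrite ?mulr0 //.
by rewrite IHq mulrDr nc_wordM -!scalerAl -!scalerAr scalerA.
Qed.

Lemma nc_normE env e : nc_poly_eval env (nc_norm e) = nc_eval env e.
Proof.
elim: e => /= [n|||e IHe|e1 IH1 e2 IH2|e1 IH1 e2 IH2|c e IHe] //.
- by rewrite scale1r mulr1 addr0.
- by rewrite scale1r addr0.
- by rewrite nc_scaleE IHe scaleN1r.
- by rewrite nc_addE IH1 IH2.
- by rewrite nc_mulE IH1 IH2.
- by rewrite nc_scaleE IHe.
Qed.

Lemma nc_eval0 env e : nc_vanishes (nc_norm e) -> nc_eval env e = 0.
Proof.
rewrite -nc_normE; elim: (nc_norm e) => [//|[w c] p IHp] /= [-> /IHp ->].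
by rewrite scale0r addr0.
Qed.

End NoncommutativePolynomials.

(* Atoms are compared up to conversion: the same term may occur with its ring
   structure inferred along different paths of the hierarchy. *)
Ltac nc_index x l :=
  lazymatch l with
  | nil => constr:(@None nat)
  | cons ?y ?l' =>
      match constr:(Set) with
      | _ => let _ := match constr:(Set) with _ => unify x y end in
             constr:(Some 0%N)
      | _ => let n := nc_index x l' in
             lazymatch n with
             | Some ?m => constr:(Some (S m))
             | None => n
             end
      end
  end.

Ltac nc_atoms e l :=
  lazymatch e with
  | @GRing.add _ ?x ?y => let l' := nc_atoms x l in nc_atoms y l'
  | @GRing.mul _ ?x ?y => let l' := nc_atoms x l in nc_atoms y l'
  | @GRing.opp _ ?x => nc_atoms x l
  | @GRing.scale _ _ _ ?x => nc_atoms x l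
  | @GRing.one _ => l
  | @GRing.zero _ => l
  | _ => let n := nc_index e l in
         lazymatch n with Some _ => l | None => constr:(cons e l) end
  end.

Ltac nc_reify K e l :=
  lazymatch e with
  | @GRing.add _ ?x ?y =>
      let x' := nc_reify K x l in let y' := nc_reify K y l in
      constr:(@NCadd K x' y')
  | @GRing.mul _ ?x ?y =>
      let x' := nc_reify K x l in let y' := nc_reify K y l in
      constr:(@NCmul K x' y')
  | @GRing.opp _ ?x => let x' := nc_reify K x l in constr:(@NCopp K x')
  | @GRing.scale _ _ ?c ?x =>
      let x' := nc_reify K x l in constr:(@NCscale K c x')
  | @GRing.one _ => constr:(@NCone K)
  | @GRing.zero _ => constr:(@NCzero K)
  | _ => let n := nc_index e l in
         lazymatch n with Some ?m => constr:(@NCvar K m) end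
  end.

Ltac nc_ring K A :=
  apply: subr0_eq;
  lazymatch goal with
  | |- ?e = _ =>
      let l := nc_atoms e (@nil A) in
      let e' := nc_reify K e l in
      change (@nc_eval K A l e' = 0)
  end;
  apply: nc_eval0;
  cbv [nc_vanishes nc_norm nc_mul nc_add nc_scale nc_insert foldr map cat
       same_word eqn fst snd andb];
  repeat split; ring.

Local Notation "[[ x , y ]]" := (commut x y) (format "[[ x ,  y ]]").
Local Notation "{{ x , y }}" := (anticommut x y) (format "{{ x ,  y }}").

(** * Identities between currents *)

Section CurrentIdentities.
Variables (K : comNzRingType) (A : algType K).

(* Here and below, k and l stand for values of (alpha_i, alpha_j)/2. *)
Definition bb_defect (k : K) (b b' : nat -> A) (r s : nat) : A :=
  [[b r.+1, b' s]] - [[b r, b' s.+1]] - k *: {{b r, b' s}}.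

(** Multiplication of the current D(u,v) by u + v. *)
Definition antidiag (D : nat -> nat -> A) (r s : nat) : A :=
  D r.+1 s + D r s.+1.

(** With X = h_{i,r-1}, Y = h_{i,r+1} and 2k = (alpha_i, alpha_j), its vanishing is the h-b relation
    with b_{j,t}. *)
Definition hb_defect (k : K) (X Y : A) (b : nat -> A) (t : nat) : A :=
  [[Y, b t]] - [[X, b t.+2]] - (2 * k) *: {{X, b t.+1}} - k ^+ 2 *: [[X, b t]].

(* The coefficient of u^r v^s w^t in
   (u - w - k)(v - w - k) D(u,v) b(w) - (u - w + k)(v - w + k) b(w) D(u,v). *)
Definition braid (k : K) (D : nat -> nat -> A) (b : nat -> A) (r s t : nat) :=
  [[D r.+1 s.+1, b t]] + [[D r s, b t.+2]] + (2 * k) *: {{D r s, b t.+1}}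
  + k ^+ 2 *: [[D r s, b t]]
  - [[antidiag D r s, b t.+1]] - k *: {{antidiag D r s, b t}}.

(** Two orders of adjacent exchanges reverse b(u) b(v) b(w); the difference of their correction
    terms is this sum over the three pairs. *)
Lemma braid_cyclic k b r s t :
  let D := bb_defect k b b in
  braid k D b r s t + braid k D b r t s + braid k D b s t r = 0.
Proof.
rewrite /braid /antidiag /bb_defect /commut /anticommut.
nc_ring K A.
Qed.

Lemma braid_mixed k l b b' r s t :
  (forall r s, bb_defect l b b' r s = 0) ->
  braid l (bb_defect k b b) b' r s t = 0.
Proof.
move=> X0.
(* With X(u,w) = (u - w - l) b(u) b'(w) - (u - w + l) b'(w) b(u), this follows
   the reordering of b(u) b(v) b'(w); p12, p13 and p23 multiply by u - v + k,
   u - w + k and v - w + k. *)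
pose p12 k (F : nat -> nat -> nat -> A) r s t :=
  F r.+1 s t - F r s.+1 t + k *: F r s t.
pose p13 k (F : nat -> nat -> nat -> A) r s t :=
  F r.+1 s t - F r s t.+1 + k *: F r s t.
pose p23 k (F : nat -> nat -> nat -> A) r s t :=
  F r s.+1 t - F r s t.+1 + k *: F r s t.
pose X := bb_defect l b b'.
transitivity (p12 (- k) (p13 (- l) (fun r s t => b r * X s t)) r s t
   + p12 (- k) (p23 l (fun r s t => X r t * b s)) r s t
   - p12 k (p23 (- l) (fun r s t => b s * X r t)) r s t
   - p12 k (p13 l (fun r s t => X s t * b r)) r s t).
  rewrite /p12 /p13 /p23 /X /braid /antidiag /bb_defect /commut /anticommut.
  nc_ring K A.
rewrite /p12 /p13 /p23 /X !X0.
by rewrite !(mulr0, mul0r, scaler0, subr0, addr0).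
Qed.

(* With X_n for [X0, X2, X4], Z the shift X_n |-> X_{n+2} and
   P_+-(w) = (w +- l)^2, the hypotheses say that (P_+(w) - Z) X b(w) and
   (P_-(w) - Z) b(w) X agree, so the same holds for products b(u) b(v) and hence
   for D(u,v).  The conclusion is the expansion of
   (P_+(u) - Z)(P_+(v) - Z) X D = (P_-(u) - Z)(P_-(v) - Z) D X in powers of
   u + v, which acts on D as [antidiag]. *)
Lemma two_step k l b X0 X2 X4 r s :
  (forall t, t \in [:: r; r.+1; s; s.+1] ->
     hb_defect l X0 X2 b t = 0 /\ hb_defect l X2 X4 b t = 0) ->
  let D := bb_defect k b b in let E := antidiag D in
  [[X4, D r s]] =
    [[X2, antidiag E r s - 2 *: D r.+1 s.+1 + (2 * l ^+ 2) *: D r s]]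
    + (2 * l) *: {{X2, E r s}}
    - [[X0, D r.+2 s.+2 + (2 * l ^+ 2) *: D r.+1 s.+1
            + l ^+ 2 *: antidiag E r s + l ^+ 4 *: D r s]]
    - (2 * l) *: {{X0, E r.+1 s.+1}} - (2 * l ^+ 3) *: {{X0, E r s}}.
Proof.
move=> T0 D E; apply: subr0_eq.
pose U := hb_defect l X0 X2 b; pose V := hb_defect l X2 X4 b.
have {}T0 : [/\ U r = 0, U r.+1 = 0, U s = 0 & U s.+1 = 0] /\
    [/\ V r = 0, V r.+1 = 0, V s = 0 & V s.+1 = 0].
  have T t : t \in [:: r; r.+1; s; s.+1] -> U t = 0 /\ V t = 0 by exact: T0.
  by split; split; apply T; rewrite !inE eqxx ?orbT.
(* [Y r s] is the error of moving the X's past [b r * b s]; the combination below repeats the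
   expansion of [D r s] in products of two b's. *)
pose Y r s := U r * (b s.+2 + (2 * l) *: b s.+1 + l ^+ 2 *: b s) - V r * b s
  + (b r.+2 - (2 * l) *: b r.+1 + l ^+ 2 *: b r) * U s - b r * V s.
transitivity (- (Y r.+1 s - Y r s.+1 - k *: Y r s
               - (Y s r.+1 - Y s.+1 r + k *: Y s r))).
  rewrite /Y /U /V /E /D /hb_defect /antidiag /bb_defect /commut /anticommut.
  nc_ring K A.
rewrite /Y; case: T0 => -[-> -> -> ->] [-> -> -> ->].
by rewrite !(mulr0, mul0r, scaler0, subr0, addr0, oppr0).
Qed.

End CurrentIdentities.

(** * Commutator calculus *)

Section Commutators.
Variables (K : comNzRingType) (A : algType K).
Implicit Types (x y z : A) (c : K).

Lemma commutC x y : [[x, y]] = - [[y, x]].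
Proof. by rewrite /commut opprB. Qed.

Lemma commutxx x : [[x, x]] = 0.
Proof. exact: subrr. Qed.

Lemma commut0r x : [[x, 0]] = 0.
Proof. by rewrite /commut mulr0 mul0r subr0. Qed.

Lemma commut0l x : [[0, x]] = 0.
Proof. by rewrite commutC commut0r oppr0. Qed.

Lemma commut1l x : [[1, x]] = 0.
Proof. by rewrite /commut mulr1 mul1r subrr. Qed.

Lemma commutDr x y z : [[x, y + z]] = [[x, y]] + [[x, z]].
Proof. by rewrite /commut; nc_ring K A. Qed.

Lemma commutZr x c y : [[x, c *: y]] = c *: [[x, y]].
Proof. by rewrite /commut; nc_ring K A. Qed.

Lemma commutNr x y : [[x, - y]] = - [[x, y]].
Proof. by rewrite /commut; nc_ring K A. Qed.

Lemma commutBr x y z : [[x, y - z]] = [[x, y]] - [[x, z]].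
Proof. by rewrite commutDr commutNr. Qed.

Lemma anticommut0r x : {{x, 0}} = 0.
Proof. by rewrite /anticommut mulr0 mul0r addr0. Qed.

Lemma hb_defect0 k b t : hb_defect k (0 : A) 0 b t = 0.
Proof. by rewrite /hb_defect /commut /anticommut; nc_ring K A. Qed.

Lemma bb_defect_sym (k : K) b r s :
  bb_defect k b b r s = bb_defect k b b s r :> A.
Proof. by rewrite /bb_defect /commut /anticommut; nc_ring K A. Qed.

Lemma commut_bb_defect (k p q : K) x (b b' : nat -> A) r s :
  (forall n, [[x, b n]] = p *: b n.+1) ->
  (forall n, [[x, b' n]] = q *: b' n.+1) ->
  [[x, bb_defect k b b' r s]] =
    p *: bb_defect k b b' r.+1 s + q *: bb_defect k b b' r s.+1.
Proof.
move=> xb xb'.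
(* Written as expressions that vanish, the hypotheses can enter an identity of noncommutative
   polynomials. *)
pose u n := [[x, b n]] - p *: b n.+1; pose v n := [[x, b' n]] - q *: b' n.+1.
have u0 n : u n = 0 by rewrite /u xb subrr.
have v0 n : v n = 0 by rewrite /v xb' subrr.
apply: subr0_eq.
transitivity ([[u r.+1, b' s]] + [[b r.+1, v s]] - [[u r, b' s.+1]]
  - [[b r, v s.+1]] - k *: {{u r, b' s}} - k *: {{b r, v s}}).
  by rewrite /u /v /bb_defect /commut /anticommut; nc_ring K A.
rewrite !u0 !v0 /anticommut !mul0r !mulr0 !commut0l !commut0r.
by rewrite !addr0 !scaler0 !subr0.
Qed.

End Commutators.

(** * Rank one *)

Section RankOne.
Variables (K : numFieldType) (A : algType K) (k : K) (b : nat -> A) (h1 : A).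
Hypothesis k_neq0 : k != 0.
Hypothesis hb : forall r, [[h1, b r]] = (4 * k) *: b r.+1.

Local Notation D := (bb_defect k b b).
Local Notation E := (antidiag D).

(* The element h_{n+1}, including those of even index, which vanish. *)
Definition h_all (n : nat) : A := - 2^-1 *: D n 0.

Lemma h_allE n : D n 0 = - 2 *: h_all n.
Proof. by rewrite /h_all scalerA mulrNN divff ?pnatr_eq0 // scale1r. Qed.

Lemma commut_h1_bb_defect r s : [[h1, D r s]] = (4 * k) *: E r s.
Proof. by rewrite (commut_bb_defect _ _ _ hb hb) -scalerDr. Qed.

(* The relations are assumed, and then proved, in total degree below M. *)
Section Truncated.
Variable M : nat.
Hypothesis E0 : forall r s, (r + s < M)%N -> E r s = 0.

Lemma D_diag r s : (r + s <= M)%N -> D r s = (-1) ^+ s *: D (r + s) 0.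
Proof.
elim: s r => [|s IHs] r; first by rewrite addn0 expr0 scale1r.
rewrite addnS => rsM; have := E0 rsM.
rewrite /antidiag => /eqP; rewrite addrC addr_eq0 => /eqP ->.
by rewrite IHs ?addSn // exprS mulN1r scaleNr.
Qed.

(** D is symmetric, so D_{n,0} = D_{0,n}, while moving along the antidiagonal multiplies by
    (-1)^n. *)
Lemma h_all_odd n : (n <= M)%N -> odd n -> h_all n = 0.
Proof.
move=> nM odd_n; suff : D n 0 = 0 by rewrite /h_all => ->; rewrite scaler0.
have := D_diag (r := 0) (s := n) nM.
rewrite add0n bb_defect_sym -signr_odd odd_n expr1 scaleN1r => /eqP.
rewrite -subr_eq0 opprK -mulr2n -scaler_nat scaler_eq0 pnatr_eq0 /=.
by move/eqP.
Qed.

(** On u = -v the [antidiag] terms drop out, and the two remaining D's are multiples of h's with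
    opposite signs. *)
Lemma braid_diag r s t : (r + s + 2 <= M)%N ->
  braid k D b r s t =
  (2 * (-1) ^+ s) *: hb_defect k (h_all (r + s)) (h_all (r + s).+2) b t.
Proof.
move=> rsM; rewrite /braid E0; last by lia.
rewrite (@D_diag r s) ?(@D_diag r.+1 s.+1); try lia.
rewrite addSn addnS !h_allE exprS.
by rewrite /hb_defect /commut /anticommut; nc_ring K A.
Qed.

Lemma hb_small n t : (n + t + 2 <= M)%N ->
  hb_defect k (h_all n) (h_all n.+2) b t = 0.
Proof.
have odd0 m u : (m + 2 <= M)%N -> odd m ->
    hb_defect k (h_all m) (h_all m.+2) b u = 0.
  move=> mM om; rewrite !h_all_odd //=; try lia.
  exact: hb_defect0.
have even_pos m u : (m + u + 2 <= M)%N -> ~~ odd m -> (odd u || (0 < m))%N ->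
    hb_defect k (h_all m) (h_all m.+2) b u = 0.
  move=> muM em oum.
  (* The split makes r + u and s + u odd, so two of the three defects in [braid_cyclic] vanish. It
     exists unless m = 0 and u is even. *)
  have [r [s [rs odd_r odd_s] ] ] : exists r s,
      [/\ (r + s = m)%N, odd (r + u) & odd (s + u)].
    have [ou|eu] := boolP (odd u).
      by exists m, 0%N; split; rewrite ?addn0 // oddD (negPf em) ou.
    exists m.-1, 1%N; move: oum em eu; rewrite !oddD.
    case: m {muM} => [|m] /=; first by rewrite orbF => ->.
    by rewrite negbK addn1 => _ -> /negPf ->.
  have := braid_cyclic k b r s u; rewrite /= !braid_diag; try lia.
  rewrite (odd0 (r + u)%N) ?(odd0 (s + u)%N) //; try lia.
  rewrite !scaler0 !addr0 rs => /eqP.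
  by rewrite scaler_eq0 mulf_eq0 signr_eq0 pnatr_eq0 /= => /eqP.
move=> ntM; have [on|en] := boolP (odd n); first by apply: odd0; lia.
have [|] := boolP (odd t || (0 < n))%N; first exact: even_pos.
rewrite negb_or -eqn0Ngt => /andP[et /eqP n0]; subst n.
(* The remaining case n = 0, t even: for t = 0 the three defects coincide; for t > 0 the other two
   are already known to vanish. *)
have := braid_cyclic k b 0 0 t; rewrite /= !braid_diag; try lia.
rewrite !add0n -(signr_odd _ t) (negPf et) !expr0 !mulr1.
have [->|t_gt0] := posnP t.
  rewrite -!scalerDl -!natrD => /eqP.
  by rewrite scaler_eq0 pnatr_eq0 /= => /eqP.
rewrite (even_pos t 0%N) ?t_gt0 ?orbT //; last by lia.
by rewrite !scaler0 !addr0 => /eqP; rewrite scaler_eq0 pnatr_eq0 /= => /eqP.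
Qed.

Hypothesis C0 : forall p q, (p + q < M)%N -> [[h_all p, h_all q]] = 0.
Hypothesis h1E : h_all 0 = h1.
Let C p := [[h_all p, h_all (M - p)]].

Lemma h_all_commut_sym p : (p <= M)%N -> C (M - p) = - C p.
Proof. by move=> pM; rewrite /C subKn // commutC. Qed.

Let D1 r s : (r + s.+1 <= M)%N ->
  D r s.+1 = (2 * (-1) ^+ s) *: h_all (r + s).+1.
Proof.
move=> rsM; rewrite D_diag // h_allE addnS scalerA exprS.
by congr (_ *: _); rewrite mulN1r mulrNN mulrC.
Qed.

(** In [two_step] with X0 = [h_all n], the E terms vanish and the D terms are multiples of h's;
    brackets of lower degree vanish by [C0]. *)
Lemma h_all_commut_rec n : (n + 6 <= M)%N -> C n.+4 = 2 *: C n.+2 - C n.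
Proof.
(* Writing the index M - n - 4 as r + 1, not as itself plus 0, keeps every h-b relation used within
   the reach of [hb_small]. *)
move=> nM; pose r := (M - n - 5)%N.
have T t : t \in [:: r; r.+1; 1%N; 2%N] ->
    hb_defect k (h_all n) (h_all n.+2) b t = 0 /\
    hb_defect k (h_all n.+2) (h_all n.+4) b t = 0.
  by rewrite !inE => t_in; rewrite !hb_small //; rewrite /r in t_in; lia.
have EE0 : antidiag E r 1 = 0.
  by rewrite {1}/antidiag !E0 ?addr0 //; rewrite /r; lia.
have := two_step k T; rewrite /= EE0 !E0; try (rewrite /r; lia).
rewrite !D1; try (rewrite /r; lia).
rewrite addn0 !addn1 !addn2.
move: C0; rewrite /C; move: h_all => H H0.
have [-> -> ->] : [/\ M - n.+4 = r.+1, M - n.+2 = r.+3 & M - n = r.+4.+1]%N.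
  by split; rewrite /r; lia.
rewrite !anticommut0r !(commutDr, commutBr, commutNr, commutZr, commut0r).
rewrite (H0 n r.+1) ?(H0 n.+2 r.+1) ?(H0 n r.+3); try (rewrite /r; lia).
move=> eqH; apply: (scalerI (a := 2)); rewrite ?pnatr_eq0 //.
move: eqH; rewrite expr0 mulr1 => ->; nc_ring K A.
Qed.

(** The same argument started one step lower, with X0 = h_{-1} = 1; the term {1, E} turns the factor
    2 into 3. *)
Lemma h_all_commut2 : (4 <= M)%N -> C 2 = 3 *: C 0.
Proof.
move=> M_ge4; pose r := (M - 3)%N.
have T t : t \in [:: r; r.+1; 1%N; 2%N] ->
    hb_defect k 1 (h_all 0) b t = 0 /\
    hb_defect k (h_all 0) (h_all 2) b t = 0.
  rewrite !inE => t_in; split; last first.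
    by rewrite hb_small //; rewrite /r in t_in; lia.
  rewrite /hb_defect h1E hb !commut1l /anticommut mulr1 mul1r.
  by nc_ring K A.
have EE0 : antidiag E r 1 = 0.
  by rewrite {1}/antidiag !E0 ?addr0 //; rewrite /r; lia.
(* This E has degree M and is not yet known to vanish, so it is kept as a bracket with h_1. *)
have E12 : (4 * k) *: E r.+1 2 = [[h_all 0, D r.+1 2]].
  by rewrite h1E commut_h1_bb_defect.
have := two_step k T; rewrite /= EE0 (E0 (r := r) (s := 1)); last first.
  by rewrite /r; lia.
have -> : {{1, E r.+1 2}} = 2 *: E r.+1 2.
  by rewrite /anticommut mulr1 mul1r; nc_ring K A.
rewrite scalerA (_ : 2 * k * 2 = 4 * k); last by ring.
rewrite E12 commut1l !D1; try (rewrite /r; lia).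
rewrite addn0 !addn1.
move: C0; rewrite /C; move: h_all => H H0.
have [-> ->] : (M - 2 = r.+1 /\ M - 0 = r.+3)%N by split; rewrite /r; lia.
rewrite !anticommut0r !(commutDr, commutBr, commutNr, commutZr, commut0r).
rewrite (H0 0 r.+1); last by rewrite /r; lia.
move=> eqH; apply: (scalerI (a := 2)); rewrite ?pnatr_eq0 //.
move: eqH; rewrite expr0 mulr1 => ->; nc_ring K A.
Qed.

(** By the recursion C is affine along even arguments p, and the ratio 3 makes it proportional to p
    + 1, the index of [h_all p]. *)
Lemma h_all_commut_linear j : (j.*2 + 2 <= M)%N -> (4 <= M)%N ->
  C j.*2 = (j.*2.+1)%:R *: C 0.
Proof.
move=> jM M_ge4; suff : C j.*2 = (j.*2.+1)%:R *: C 0 /\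
    ((j.*2 + 4 <= M)%N -> C j.+1.*2 = (j.+1.*2.+1)%:R *: C 0) by case.
elim: j jM => [|j IHj] jM; first by rewrite scale1r h_all_commut2.
have [|Cj Cj1] := IHj; first by lia.
split=> [|j1M]; first by apply: Cj1; lia.
rewrite !doubleS h_all_commut_rec -?doubleS; last by lia.
rewrite Cj1 ?Cj; last by lia.
rewrite scalerA -scalerBl; congr (_ *: _).
by rewrite -natrM -natrB; [congr _%:R|]; lia.
Qed.

Hypothesis h1h3 : [[h1, D 1 1]] = 0.

Lemma h_all_commut0 : [[h_all 0, h_all M]] = 0.
Proof.
have [oM|eM] := boolP (odd M); first by rewrite (h_all_odd _ oM) // commut0r.
have [M_ge4|] := leqP 4 M; last first.
  have [->|M_gt0] := posnP M; first by rewrite commutxx.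
  move=> M_lt4; have M2 : M = 2%N by lia.
  have := h1h3; rewrite D1 ?M2 // commutZr expr0 mulr1 h1E => /eqP.
  by rewrite scaler_eq0 pnatr_eq0 => /eqP.
(* C (M - 2) in two ways gives (M - 1) C_0 = -3 C_0. *)
have := h_all_commut_sym (p := 2); rewrite (h_all_commut2 M_ge4).
have -> : (M - 2 = (M./2).-1.*2)%N by lia.
rewrite h_all_commut_linear //; try lia.
move=> /(_ (ltnW (ltnW M_ge4)))/eqP; rewrite -subr_eq0 opprK -scalerDl -natrD.
by rewrite scaler_eq0 pnatr_eq0 addnS /= {1}/C subn0 => /eqP.
Qed.

Lemma h_all_commut_step p q : (p + q = M)%N -> [[h_all p, h_all q]] = 0.
Proof.
move=> pqM; have [op|ep] := boolP (odd p).
  by rewrite h_all_odd ?commut0l //; lia.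
have [oq|eq] := boolP (odd q).
  by rewrite (h_all_odd _ oq) ?commut0r //; lia.
have [q0|q_gt0] := posnP q.
  by rewrite commutC q0 (_ : p = M) ?h_all_commut0 ?oppr0 //; lia.
have [p0|p_gt0] := posnP p.
  by rewrite p0 (_ : q = M) ?h_all_commut0 //; lia.
have := h_all_commut_linear (j := p./2); rewrite /C subn0 h_all_commut0 scaler0.
have -> : (p./2.*2 = p)%N by lia.
have -> : (M - p = q)%N by lia.
apply; lia.
Qed.

End Truncated.

(** * Removing the degree bound *)

Section Full.
Hypothesis h1E : h_all 0 = h1.
Hypothesis h1h3 : [[h1, D 1 1]] = 0.

(** In degree M the h's commute first, from the relations below M; as D is a multiple of an h there,
    [h_1, D] = 0 and E vanishes too. *)
Lemma rank_one_induction M :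
  (forall r s, (r + s < M)%N -> E r s = 0) /\
  (forall p q, (p + q < M)%N -> [[h_all p, h_all q]] = 0).
Proof.
elim: M => [//|M [E0 C0] ]; have C1 := h_all_commut_step E0 C0 h1E h1h3.
split=> [r s|p q]; rewrite ltnS leq_eqVlt => /predU1P[rsM|]; last 1 first.
- exact: C0.
- have /eqP : (4 * k) *: E r s = 0.
    rewrite -commut_h1_bb_defect (D_diag E0) ?rsM // h_allE 2!commutZr.
    by rewrite -h1E C1 // !scaler0.
  by rewrite scaler_eq0 mulf_eq0 pnatr_eq0 (negPf k_neq0) /= => /eqP.
- exact: E0.
- exact: C1.
Qed.

Lemma antidiag_bb_defect r s : E r s = 0.
Proof. by have [E0 _] := rank_one_induction (r + s).+1; exact: E0. Qed.

Lemma commut_h_all p q : [[h_all p, h_all q]] = 0.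
Proof. by have [_ C0] := rank_one_induction (p + q).+1; exact: C0. Qed.

Lemma bb_defect_diag r s : D r s = (- 2 * (-1) ^+ s) *: h_all (r + s).
Proof.
rewrite (D_diag (M := r + s)) // => [|r' s' _]; last exact: antidiag_bb_defect.
by rewrite h_allE scalerA mulrC.
Qed.

Lemma h_all_odd0 n : odd n -> h_all n = 0.
Proof.
by apply: (h_all_odd (M := n)) => // r s _; exact: antidiag_bb_defect.
Qed.

Lemma hb_defect_h_all n t : hb_defect k (h_all n) (h_all n.+2) b t = 0.
Proof.
apply: (hb_small (M := n + t + 2)) => // r s _; exact: antidiag_bb_defect.
Qed.

End Full.

End RankOne.

Lemma commut_jacobi (K : comNzRingType) (A : algType K) (x y z : A) :
  [[x, [[y, z]]]] = [[y, [[x, z]]]] + [[ [[x, y]], z]].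
Proof. by rewrite /commut; nc_ring K A. Qed.

(** * Arbitrary rank *)

Section Reconstruction.
Variables (K : numFieldType) (I : finType) (ip : I -> I -> K) (A : algType K).
Variables (h1 b0 b1 : I -> A).
Hypothesis ip_sym : forall i j, ip i j = ip j i.
Hypothesis ip_neq0 : forall i, ip i i != 0.
Hypothesis ip_det : forall i j, i != j -> ip i i * ip j j != ip i j ^+ 2.
Hypothesis h1_commut : forall i j, [[h1 i, h1 j]] = 0.
Hypothesis h1b0 : forall i j, [[h1 i, b0 j]] = (2 * ip i j) *: b1 j.
Hypothesis b1b0 : forall i j, [[b1 i, b0 j]] - [[b0 i, b1 j]] =
  (ip i j / 2) *: {{b0 i, b0 j}} - (2 * (i == j)%:R) *: h1 i.

Let k i j := ip i j / 2.

Let k_sym i j : k i j = k j i. Proof. by rewrite /k ip_sym. Qed.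

Let k_neq0 i : k i i != 0.
Proof. by rewrite mulf_neq0 ?invr_eq0 ?pnatr_eq0. Qed.

Let k2 i j : 2 * k i j = ip i j.
Proof. by rewrite /k mulrC divfK ?pnatr_eq0. Qed.

Let k4 i j : 4 * k i j = 2 * ip i j.
Proof. by rewrite -k2; ring. Qed.

Definition b_seq (i : I) (r : nat) : A :=
  iter r (fun x => (2 * ip i i)^-1 *: [[h1 i, x]]) (b0 i).

Let two_ip_neq0 i : 2 * ip i i != 0.
Proof. by rewrite mulf_neq0 ?pnatr_eq0. Qed.

Lemma b_seq1 i : b_seq i 1 = b1 i.
Proof. by rewrite /b_seq /= h1b0 scalerA mulVf ?scale1r. Qed.

Lemma h1_b_seq i j r : [[h1 i, b_seq j r]] = (4 * k i j) *: b_seq j r.+1.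
Proof.
elim: r => [|r IHr]; first by rewrite b_seq1 h1b0 k4.
rewrite [b_seq j r.+1]/= commutZr commut_jacobi h1_commut commut0l addr0 IHr.
by rewrite commutZr scalerA [_ * (4 * _)]mulrC -[LHS]scalerA.
Qed.

Local Notation D i := (bb_defect (k i i) (b_seq i) (b_seq i)).
Local Notation E i := (antidiag (D i)).
Local Notation h i := (h_all (k i i) (b_seq i)).

Lemma bb_defect00 i : D i 0 0 = - 2 *: h1 i.
Proof.
rewrite /bb_defect !b_seq1 b1b0 eqxx mulr1 addrAC [X in X + _]subrr.
by rewrite sub0r scaleNr.
Qed.

Lemma h_all0 i : h i 0 = h1 i.
Proof.
by rewrite /h_all bb_defect00 scalerA mulrNN mulVf ?scale1r ?pnatr_eq0.
Qed.

Lemma commut_h1_bb i j r s : [[h1 i, D j r s]] = (4 * k i j) *: E j r s.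
Proof.
by rewrite (commut_bb_defect _ _ _ (h1_b_seq i j) (h1_b_seq i j)) -scalerDr.
Qed.

Lemma antidiag_eq0 i r s : [[h1 i, D i r s]] = 0 -> E i r s = 0.
Proof.
rewrite commut_h1_bb => /eqP.
by rewrite scaler_eq0 mulf_eq0 pnatr_eq0 (negPf (k_neq0 i)) => /eqP.
Qed.

Lemma antidiag00 i : E i 0 0 = 0.
Proof.
by apply: antidiag_eq0; rewrite bb_defect00 commutZr commutxx scaler0.
Qed.

Lemma bb_defect10 i : D i 1 0 = 0.
Proof.
have := antidiag00 i; rewrite /antidiag [D i 0 1]bb_defect_sym => /eqP.
by rewrite -mulr2n -scaler_nat scaler_eq0 pnatr_eq0 => /eqP.
Qed.

Lemma antidiag10 i : E i 1 0 = 0.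
Proof. by apply: antidiag_eq0; rewrite bb_defect10 commut0r. Qed.

Lemma antidiag01 i : E i 0 1 = 0.
Proof. by apply: antidiag_eq0; rewrite bb_defect_sym bb_defect10 commut0r. Qed.

Lemma bb_defect_neq i j r s : i != j ->
  bb_defect (k i j) (b_seq i) (b_seq j) r s = 0.
Proof.
move=> ij; set X := bb_defect _ _ _.
have hX l p q : [[h1 l, X p q]] =
    (4 * k l i) *: X p.+1 q + (4 * k l j) *: X p q.+1.
  by rewrite (commut_bb_defect _ _ _ (h1_b_seq l i) (h1_b_seq l j)).
have step p q : X p q = 0 -> X p.+1 q = 0 /\ X p q.+1 = 0.
  move=> Xpq; have := hX i p q; have := hX j p q; rewrite Xpq !commut0r.
  move: (X p.+1 q) (X p q.+1) => x y eqj eqi.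
  have det : 16 * (k i i * k j j - k i j ^+ 2) != 0.
    rewrite mulf_neq0 ?pnatr_eq0 // /k subr_eq0.
    have -> : ip i i / 2 * (ip j j / 2) = ip i i * ip j j / 4 by field.
    have -> : (ip i j / 2) ^+ 2 = ip i j ^+ 2 / 4 by field.
    by rewrite (inj_eq (mulIf _)) ?ip_det // invr_eq0 pnatr_eq0.
  (* Cramer's rule for the equations from h_i and h_j. *)
  split; apply/eqP; rewrite -[_ == 0]orFb -(negPf det) -scaler_eq0; apply/eqP.
    transitivity ((4 * k j j) *: ((4 * k i i) *: x + (4 * k i j) *: y)
        - (4 * k i j) *: ((4 * k j i) *: x + (4 * k j j) *: y)).
      by rewrite (k_sym j i); nc_ring K A.
    by rewrite -eqi -eqj !scaler0 subr0.
  transitivity ((4 * k i i) *: ((4 * k j i) *: x + (4 * k j j) *: y)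
        - (4 * k j i) *: ((4 * k i i) *: x + (4 * k i j) *: y)).
    by rewrite (k_sym j i); nc_ring K A.
  by rewrite -eqi -eqj !scaler0 subr0.
elim: r s => [|r IHr] s; last by case: (step r s (IHr s)).
elim: s => [|s IHs]; last by case: (step 0%N s IHs).
by rewrite /X /bb_defect !b_seq1 b1b0 (negPf ij) mulr0 scale0r subr0 subrr.
Qed.

(** Only two values of E enter, so the case n = 0 is available before h_{i,1} and h_{i,3} are known
    to commute. *)
Lemma hb_defect_neq i j n t : i != j -> E i n 0 = 0 -> E i n.+1 0 = 0 ->
  hb_defect (k i j) (h i n) (h i n.+2) (b_seq j) t = 0.
Proof.
move=> ij En En1.
have := braid_mixed (k i i) n 0 t (fun r s => bb_defect_neq r s ij).
rewrite /braid En (_ : D i n.+1 1 = - D i n.+2 0); last first.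
  by move/eqP: En1; rewrite /antidiag addrC addr_eq0 => /eqP.
rewrite !h_allE; move: (h i n) (h i n.+2) => x y eqD.
apply: (scalerI (a := 2)); rewrite ?pnatr_eq0 // scaler0 -[RHS]eqD.
by rewrite /hb_defect /commut /anticommut; nc_ring K A.
Qed.

Lemma hb_defect_h1 i j t : hb_defect (k i j) 1 (h1 i) (b_seq j) t = 0.
Proof.
rewrite /hb_defect h1_b_seq !commut1l /anticommut mulr1 mul1r.
by nc_ring K A.
Qed.

(** [two_step] with X0, X2, X4 = 1, h_{i,1}, h_{i,3} on D_{0,0} = -2 h_{j,1}; only E_{1,1} survives,
    with 8k from [X2, D] and 4k from {1, E}. *)
Lemma commut_h3_h1 i j : i != j -> [[h i 2, h1 j]] = (6 * k i j) *: E j 1 1.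
Proof.
move=> ij; have T t : t \in [:: 0%N; 1%N; 0%N; 1%N] ->
    hb_defect (k i j) 1 (h1 i) (b_seq j) t = 0 /\
    hb_defect (k i j) (h1 i) (h i 2) (b_seq j) t = 0.
  split; rewrite ?hb_defect_h1 // -(h_all0 i).
  by rewrite hb_defect_neq ?antidiag00 ?antidiag10.
have := two_step (k j j) T; rewrite /= [antidiag (E j) 0 0]/antidiag.
rewrite antidiag10 antidiag01 antidiag00 bb_defect00 !commut1l commutDr.
rewrite commutBr !commutZr commut_h1_bb.
rewrite !commutDr h1_commut commut0r /anticommut !mulr0 !mul0r mul1r mulr1.
move=> eqh; apply: (scalerI (a := - 2)); first by rewrite oppr_eq0 pnatr_eq0.
by rewrite eqh; nc_ring K A.
Qed.

(* Exchanging i and j in E_i = -3 E_j gives E_i = 9 E_i. *)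
Lemma h1h3_neighbour i j : i != j -> ip i j != 0 -> [[h1 i, D i 1 1]] = 0.
Proof.
move=> ij ipij.
have half l : D l 1 1 = 2 *: h l 2.
  have /eqP := antidiag10 l; rewrite /antidiag addrC addr_eq0 => /eqP ->.
  by rewrite h_allE scaleNr opprK.
(* [h_{m,1}, h_{l,3}] is computed once from the action on b_l and once from [commut_h3_h1]. *)
have rel l m : l != m -> ip l m != 0 -> E l 1 1 = - 3 *: E m 1 1.
  move=> lm iplm; have k0 : 4 * k l m != 0.
    by rewrite k4 mulf_neq0 ?pnatr_eq0.
  apply: (scalerI k0); rewrite {1}k_sym -commut_h1_bb half commutZr commutC.
  by rewrite commut_h3_h1 //; nc_ring K A.
have Eij := rel i j ij ipij.
have := rel j i; rewrite eq_sym ij ip_sym ipij => /(_ isT isT) Eji.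
rewrite commut_h1_bb; suff -> : E i 1 1 = 0 by rewrite scaler0.
move: Eij; rewrite Eji scalerA => /eqP.
rewrite -subr_eq0 -{1}[E i 1 1]scale1r -scalerBl scaler_eq0 mulrNN -natrM.
by rewrite -[1]/(1%:R) -opprB oppr_eq0 -natrB // pnatr_eq0 => /eqP.
Qed.

(** Since [h_1, b_1] = 4k b_2, the relation says that h_1 commutes with 4k [b_1, b_2] + 4k^2 b_1^2,
    which is -2k D_{1,1}. *)
Lemma h1h3_extra i :
  [[h1 i, [[b1 i, [[h1 i, b1 i]]]]]] = ip i i ^+ 2 *: [[b1 i ^+ 2, h1 i]] ->
  [[h1 i, D i 1 1]] = 0.
Proof.
rewrite -b_seq1 h1_b_seq -k2 => extra.
apply: (scalerI (a := 2 * k i i)); first by rewrite mulf_neq0 ?pnatr_eq0.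
transitivity (- ([[h1 i, [[b_seq i 1, (4 * k i i) *: b_seq i 2]]]]
  - (2 * k i i) ^+ 2 *: [[b_seq i 1 ^+ 2, h1 i]])).
  by rewrite !expr2 /bb_defect /commut /anticommut; nc_ring K A.
by rewrite extra subrr oppr0 scaler0.
Qed.

(** * All Drinfeld relations from [h_{i,1}, h_{i,3}] = 0 *)

Section Drinfeld.
Hypothesis h1h3 : forall i, [[h1 i, D i 1 1]] = 0.

Let E0 i r s : E i r s = 0.
Proof.
exact: (antidiag_bb_defect (k_neq0 i) (h1_b_seq i i) (h_all0 i) (h1h3 i)).
Qed.

Let D_diag i r s : D i r s = (- 2 * (-1) ^+ s) *: h i (r + s).
Proof.
exact: (bb_defect_diag (k_neq0 i) (h1_b_seq i i) (h_all0 i) (h1h3 i)).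
Qed.

Let h_odd i n : odd n -> h i n = 0.
Proof.
exact: (h_all_odd0 (k_neq0 i) (h1_b_seq i i) (h_all0 i) (h1h3 i)).
Qed.

Let hb_h i j n t : hb_defect (k i j) (h i n) (h i n.+2) (b_seq j) t = 0.
Proof.
have [<-|ij] := eqVneq i j; last exact: hb_defect_neq.
exact: (hb_defect_h_all (k_neq0 i) (h1_b_seq i i) (h_all0 i) (h1h3 i)).
Qed.

(* The element h_{i,n-1}. *)
Let h_shift i n := match n with 0 => 1 | 1 => 0 | m.+2 => h i m end.

Let hb_h_shift i j n t :
  hb_defect (k i j) (h_shift i n) (h_shift i n.+2) (b_seq j) t = 0.
Proof.
case: n => [|[|n] ] /=; last exact: hb_h.
  by rewrite h_all0 hb_defect_h1.
by rewrite h_odd // hb_defect0.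
Qed.

(** For i <> j, strong induction on the shifted index, uniformly in q: [two_step] on D_{q,0} lowers
    it by 2 and 4, down to 1, 0 and h_{i,1}. *)
Lemma h_commut i j p q : [[h i p, h j q]] = 0.
Proof.
have [<-|ij] := eqVneq i j.
  exact: (commut_h_all (k_neq0 i) (h1_b_seq i i) (h_all0 i) (h1h3 i)).
suff H n : [[h_shift i n, h j q]] = 0 by exact: (H p.+2).
have [m] := ubnP n; elim: m n q => // m IHm [|[|[|[|n] ] ] ] q nm /=.
- exact: commut1l.
- exact: commut0l.
- rewrite h_all0 /h_all commutZr commut_h1_bb.
  by rewrite E0 !scaler0.
- by rewrite h_odd // commut0l.
have T t : t \in [:: q; q.+1; 0%N; 1%N] ->
    hb_defect (k i j) (h_shift i n) (h_shift i n.+2) (b_seq j) t = 0 /\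
    hb_defect (k i j) (h_shift i n.+2) (h_shift i n.+4) (b_seq j) t = 0.
  by move=> _; split; exact: hb_h_shift.
have := two_step (k j j) T; rewrite /= [antidiag (E j) q 0]/antidiag.
rewrite !E0 !D_diag -![h i n.+2]/(h_shift i n.+4) -![h i n]/(h_shift i n.+2).
move: h_shift (h j) IHm {T} => hs H IHm.
rewrite !(commutDr, commutBr, commutNr, commutZr, commut0r) !anticommut0r.
rewrite !(IHm n) ?(IHm n.+2); try lia.
rewrite addn0 !(scaler0, addr0, subr0, oppr0, expr0, mulr1) => /eqP.
by rewrite scaler_eq0 oppr_eq0 pnatr_eq0 => /eqP.
Qed.

(** [h i n] is h_{i,n+1}, so h_{i,2m+1} has argument 2m. *)
Definition h_odd_seq (i : I) (m : nat) : A := h i m.*2.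

Lemma h_ext_h_all i n : h_ext h_odd_seq i n.+1 = h i n.
Proof.
rewrite /= /h_odd_seq; have [on|en] /= := boolP (odd n); first by rewrite h_odd.
by congr (h_all _ _ _); lia.
Qed.

Hypothesis serre : forall x y, serre_rel ip b0 x y -> x = y.

Theorem drinfeld_relations x y : drinfeld_rel ip h_odd_seq b_seq x y -> x = y.
Proof.
case=> {x y} [i j r s hh|i j r s hh|i j r s hh|x y]; last exact: serre.
- rewrite /hh; case: r => [|r]; first exact: commut0l.
  case: s => [|s]; first exact: commut0r.
  by rewrite !h_ext_h_all h_commut.
- have -> : hh i (r%:Z + 1) = h_shift i r.+2.
    by rewrite /hh -PoszD addn1 h_ext_h_all.
  have -> : hh i (r%:Z - 1) = h_shift i r.
    rewrite /hh; case: r => [|[|r] ]; [by rewrite sub0r|by rewrite subrr|].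
    have -> : r.+2%:Z - 1 = r.+1 by rewrite -addn1 PoszD addrK.
    exact: h_ext_h_all.
  apply: subr0_eq; rewrite -[RHS](hb_h_shift i j r s) /hb_defect k2.
  have -> : k i j ^+ 2 = ip i j ^+ 2 / 4 by rewrite /k; field.
  by nc_ring K A.
- rewrite /hh h_ext_h_all; have [<-|ij] := eqVneq i j.
    apply: subr0_eq; have /eqP := D_diag i r s.
    rewrite -subr_eq0 => /eqP <-.
    by rewrite /bb_defect [2 * true%:R]mulr1 /k; nc_ring K A.
  rewrite mulr0 mul0r scale0r subr0; apply: subr0_eq.
  by rewrite -[RHS](bb_defect_neq r s ij).
Qed.

End Drinfeld.
End Reconstruction.

(** * The isomorphism *)

Section RelationTransfer.
Variables (K : fieldType) (I : finType) (ip : I -> I -> K) (A B : algType K).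
Variable f : {lrmorphism A -> B}.

Lemma rmorph_commut x y : f [[x, y]] = [[f x, f y]].
Proof. by rewrite rmorphB !rmorphM. Qed.

Lemma rmorph_anticommut x y : f {{x, y}} = {{f x, f y}}.
Proof. by rewrite rmorphD !rmorphM. Qed.

Lemma rmorph_h_ext hodd (i : I) r :
  f (h_ext hodd i r) = h_ext (fun i m => f (hodd i m)) i r.
Proof.
case: r => [n|[|n] ] /=; rewrite ?rmorph1 ?rmorph0 //.
by case: ifP; rewrite ?rmorph0.
Qed.

Let fB x y : f (x - y) = f x - f y. Proof. exact: rmorphB. Qed.
Let fD x y : f (x + y) = f x + f y. Proof. exact: rmorphD. Qed.
Let fZ c x : f (c *: x) = c *: f x. Proof. exact: linearZ. Qed.
Let fX x n : f (x ^+ n) = f x ^+ n. Proof. exact: rmorphXn. Qed.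
Let f0 : f 0 = 0. Proof. exact: rmorph0. Qed.
Let fE := (rmorph_commut, rmorph_anticommut, rmorph_h_ext, fX, fB, fD, fZ, f0).

Lemma rmorph_bb_defect (c : K) a b a' b' r s :
  (forall n, f (a n) = a' n) -> (forall n, f (b n) = b' n) ->
  f (bb_defect c a b r s) = bb_defect c a' b' r s.
Proof. by move=> fa fb; rewrite /bb_defect !fE !fa !fb. Qed.

(** Used with f the projection from a free algebra: relations among generators of the quotient lift
    to the defining ones. *)
Definition preimage_rel (E : A -> A -> Prop) (x y : B) : Prop :=
  exists u v, [/\ E u v, x = f u & y = f v].

Lemma serre_rel_preimage b0 x y :
  serre_rel ip (fun i => f (b0 i)) x y -> preimage_rel (serre_rel ip b0) x y.
Proof.
case=> i j ij cij.
- by eexists; eexists; split; [exact: (Serre0 b0 ij cij)| |]; rewrite !fE.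
- by eexists; eexists; split; [exact: (Serre1 b0 ij cij)| |]; rewrite !fE.
- by eexists; eexists; split; [exact: (Serre2 b0 ij cij)| |]; rewrite !fE.
- by eexists; eexists; split; [exact: (Serre3 b0 ij cij)| |]; rewrite !fE.
Qed.

Lemma serre_rel_image b0 x y :
  serre_rel ip b0 x y -> serre_rel ip (fun i => f (b0 i)) (f x) (f y).
Proof.
pose fb0 i := f (b0 i); case=> i j ij cij; rewrite !fE.
- exact: (Serre0 fb0 ij cij).
- exact: (Serre1 fb0 ij cij).
- exact: (Serre2 fb0 ij cij).
- exact: (Serre3 fb0 ij cij).
Qed.

Lemma drinfeld_rel_preimage hodd b x y :
  drinfeld_rel ip (fun i m => f (hodd i m)) (fun i r => f (b i r)) x y ->
  preimage_rel (drinfeld_rel ip hodd b) x y.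
Proof.
case=> {x y} [i j r s h|i j r s h|i j r s h|x y xy].
- by eexists; eexists; split; [exact: (Drinfeld_hh _ _ _ i j r s)| |];
    rewrite !fE.
- by eexists; eexists; split; [exact: (Drinfeld_hb _ _ _ i j r s)| |];
    rewrite !fE.
- by eexists; eexists; split; [exact: (Drinfeld_bb _ _ _ i j r s)| |];
    rewrite !fE.
- have [u [v [uv -> ->] ] ] := serre_rel_preimage xy.
  by exists u, v; split=> //; exact: Drinfeld_serre.
Qed.

Lemma drinfeld_rel_image hodd b hodd' b' x y :
  (forall i m, f (hodd i m) = hodd' i m) -> (forall i r, f (b i r) = b' i r) ->
  drinfeld_rel ip hodd b x y -> drinfeld_rel ip hodd' b' (f x) (f y).
Proof.
move=> /(fun e i => funext (e i))/funext <-.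
move=> /(fun e i => funext (e i))/funext <-.
pose fh i m := f (hodd i m); pose fb i r := f (b i r).
case=> {x y} [i j r s h|i j r s h|i j r s h|x y xy]; rewrite ?fE.
- exact: (Drinfeld_hh ip fh fb i j r s).
- exact: (Drinfeld_hb ip fh fb i j r s).
- exact: (Drinfeld_bb ip fh fb i j r s).
- exact: Drinfeld_serre (serre_rel_image xy).
Qed.

Lemma reduced_rel_preimage i0 h1 b0 b1 x y :
  reduced_rel ip i0 (fun i => f (h1 i)) (fun i => f (b0 i))
    (fun i => f (b1 i)) x y ->
  preimage_rel (reduced_rel ip i0 h1 b0 b1) x y.
Proof.
case=> {x y} [i j|i j|i j|x y xy|extra].
- by eexists; eexists; split; [exact: (Reduced_hh _ _ _ _ _ i j)| |];
    rewrite !fE.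
- by eexists; eexists; split; [exact: (Reduced_hb _ _ _ _ _ i j)| |];
    rewrite !fE.
- by eexists; eexists; split; [exact: (Reduced_bb _ _ _ _ _ i j)| |];
    rewrite !fE.
- have [u [v [uv -> ->] ] ] := serre_rel_preimage xy.
  by exists u, v; split=> //; exact: Reduced_serre.
- by eexists; eexists; split; [exact: (Reduced_extra _ _ _ _ extra)| |];
    rewrite !fE.
Qed.

Lemma reduced_rel_image i0 h1 b0 b1 h1' b0' b1' x y :
  (forall i, f (h1 i) = h1' i) -> (forall i, f (b0 i) = b0' i) ->
  (forall i, f (b1 i) = b1' i) -> reduced_rel ip i0 h1 b0 b1 x y ->
  reduced_rel ip i0 h1' b0' b1' (f x) (f y).
Proof.
move=> /funext <- /funext <- /funext <-.
pose fh1 i := f (h1 i); pose fb0 i := f (b0 i); pose fb1 i := f (b1 i).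
case=> {x y} [i j|i j|i j|x y xy|extra]; rewrite ?fE.
- exact: (Reduced_hh ip i0 fh1 fb0 fb1 i j).
- exact: (Reduced_hb ip i0 fh1 fb0 fb1 i j).
- exact: (Reduced_bb ip i0 fh1 fb0 fb1 i j).
- exact: Reduced_serre (serre_rel_image xy).
- exact: (Reduced_extra i0 fh1 fb0 fb1 extra).
Qed.

End RelationTransfer.

(** * The reduced relations inside the Drinfeld presentation *)

Section DrinfeldConsequences.
Variables (K : numFieldType) (I : finType) (ip : I -> I -> K) (A : algType K).
Variables (hodd b : I -> nat -> A).
Hypothesis rel : forall x y, drinfeld_rel ip hodd b x y -> x = y.

Lemma drinfeld_h1b i j r : [[hodd i 0, b j r]] = (2 * ip i j) *: b j r.+1.
Proof.
(* At r = 0 the convention h_{i,-1} = 1 removes both commutators with h_{i,r-1}. *)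
have := rel (Drinfeld_hb ip hodd b i j 0 r).
rewrite sub0r add0r /= !commut1l subr0 scaler0 addr0 => ->.
by rewrite /anticommut mulr1 mul1r; nc_ring K A.
Qed.

Lemma drinfeld_bb i r s : bb_defect (ip i i / 2) (b i) (b i) r s =
  (- 2 * (-1) ^+ s) *: h_ext hodd i (r + s).+1.
Proof.
rewrite /bb_defect (rel (Drinfeld_bb ip hodd b i i r s)) eqxx mulr1.
by nc_ring K A.
Qed.

Lemma reduced_of_drinfeld i0 x y :
  reduced_rel ip i0 (hodd^~ 0%N) (b^~ 0%N) (b^~ 1%N) x y -> x = y.
Proof.
case=> {x y} [i j|i j|i j|x y xy|_].
- exact: (rel (Drinfeld_hh ip hodd b i j 1 1)).
- exact: drinfeld_h1b.
- have := rel (Drinfeld_bb ip hodd b i j 0 0).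
  by rewrite expr0 mulr1 /=.
- by apply: rel; exact: Drinfeld_serre.
(* D_{1,1} = 2 h_{i0,3}, so the additional relation restates [h_{i0,1}, h_{i0,3}] = 0. *)
have := drinfeld_bb i0 1 1; rewrite /= expr1 mulrNN mulr1 => h3.
have h13 : [[hodd i0 0, bb_defect (ip i0 i0 / 2) (b i0) (b i0) 1 1]] = 0.
  rewrite h3 commutZr.
  by rewrite [commut _ _](rel (Drinfeld_hh ip hodd b i0 i0 1 3)) scaler0.
have ipE : ip i0 i0 = 2 * (ip i0 i0 / 2) by field.
rewrite drinfeld_h1b ipE; move: (ip i0 i0 / 2) h13 => c h13; apply: subr0_eq.
transitivity (- (2 * c) *: [[hodd i0 0, bb_defect c (b i0) (b i0) 1 1]]).
  by rewrite !expr2 /bb_defect /commut /anticommut; nc_ring K A.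
by rewrite h13 scaler0.
Qed.

End DrinfeldConsequences.

(** * The two mutually inverse homomorphisms *)

Section Isomorphism.
Variables (K : numFieldType) (I : finType) (ip : I -> I -> K) (i0 : I).
Hypothesis ip_sym : forall i j, ip i j = ip j i.
Hypothesis ip_neq0 : forall i, ip i i != 0.
Hypothesis ip_det : forall i j, i != j -> ip i i * ip j j != ip i j ^+ 2.
Hypothesis ip_connected : forall i j, i != j ->
  exists2 l, i != l & ip i l != 0.

Local Notation Y := (twisted_yangian ip).
Local Notation R := (reduced_yangian ip i0).
Local Notation h1 := (reduced_h1 ip i0).
Local Notation b0 := (reduced_b0 ip i0).
Local Notation b1 := (reduced_b1 ip i0).

Lemma yangian_rel (x y : Y) :
  drinfeld_rel ip (yangian_hodd ip) (yangian_b ip) x y -> x = y.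
Proof.
move=> xy; pose J := proper_relation_ideal (@drinfeld_aug K I ip).
have [u [v [uv -> ->] ] ] := @drinfeld_rel_preimage _ _ ip _ _ (alg_pi J)
  (@free_hodd K I) (@free_b K I) x y xy.
exact: presented_rel.
Qed.

Lemma reduced_yangian_rel (x y : R) : reduced_rel ip i0 h1 b0 b1 x y -> x = y.
Proof.
move=> xy; pose J := proper_relation_ideal (@reduced_aug K I ip i0).
have [u [v [uv -> ->] ] ] := @reduced_rel_preimage _ _ ip _ _ (alg_pi J) i0
  (@free_h1 K I) (@free_b0 K I) (@free_b1 K I) x y xy.
exact: presented_rel.
Qed.

Let h1_commut i j : [[h1 i, h1 j]] = 0.
Proof. exact: reduced_yangian_rel (Reduced_hh _ _ _ _ _ i j). Qed.

Let h1b0 i j : [[h1 i, b0 j]] = (2 * ip i j) *: b1 j.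
Proof. exact: reduced_yangian_rel (Reduced_hb _ _ _ _ _ i j). Qed.

Let b1b0 i j : [[b1 i, b0 j]] - [[b0 i, b1 j]] =
  (ip i j / 2) *: {{b0 i, b0 j}} - (2 * (i == j)%:R) *: h1 i.
Proof. exact: reduced_yangian_rel (Reduced_bb _ _ _ _ _ i j). Qed.

(** Without a neighbour for i0, the additional relation must supply [h_{i,1}, h_{i,3}] = 0; this
    makes it available. *)
Lemma has_type_A1 : (forall j, i0 = j) -> has_type ip cartan_A1.
Proof.
move=> I1; exists (fun _ => i0).
  by exists (fun _ => ord0) => [k|j]; rewrite ?ord1 // -I1.
move=> k l; rewrite /cartan_entry /half_norm !ord1 mxE eqxx mulr1n.
by rewrite invf_div mulrCA divff ?mulr1.
Qed.

Let rb := b_seq ip h1 b0.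
Let rh := h_odd_seq ip h1 b0.

Lemma reduced_h1h3 i :
  [[h1 i, bb_defect (ip i i / 2) (rb i) (rb i) 1 1]] = 0.
Proof.
have [ [j ij]|alone] := pselect (exists j, i != j).
  have [l il ipil] := ip_connected ij.
  exact: (h1h3_neighbour ip_sym ip_neq0 ip_det h1_commut h1b0 b1b0 il).
have I1 j : i = j by apply/eqP/negPn/negP => ij; apply: alone; exists j.
have ii0 := I1 i0; subst i; apply: (h1h3_extra ip_neq0 h1_commut h1b0).
apply: reduced_yangian_rel; apply: Reduced_extra.
by apply: Or31; exact: has_type_A1.
Qed.

Lemma reduced_drinfeld_rel x y : drinfeld_rel ip rh rb x y -> x = y.
Proof.
apply: (drinfeld_relations ip_sym ip_neq0 ip_det h1_commut h1b0 b1b0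
          reduced_h1h3).
by move=> u v uv; exact: reduced_yangian_rel (Reduced_serre _ _ _ uv).
Qed.

Let to_yangian_gen (x : reduced_gen I) : Y :=
  match x with
  | inl i => yangian_hodd ip i 0
  | inr (inl i) => yangian_b ip i 0
  | inr (inr i) => yangian_b ip i 1
  end.

Lemma to_yangian_rel x y :
  reduced_rel ip i0 (@free_h1 K I) (@free_b0 K I) (@free_b1 K I) x y ->
  free_lift to_yangian_gen x = free_lift to_yangian_gen y.
Proof.
move=> xy; apply: (reduced_of_drinfeld yangian_rel (i0 := i0)).
by apply: reduced_rel_image xy => i; exact: free_lift_gen.
Qed.

Let from_yangian_gen (x : drinfeld_gen I) : R :=
  match x with inl (i, m) => rh i m | inr (i, r) => rb i r end.

Lemma from_yangian_rel x y :
  drinfeld_rel ip (@free_hodd K I) (@free_b K I) x y ->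
  free_lift from_yangian_gen x = free_lift from_yangian_gen y.
Proof.
move=> xy; apply: reduced_drinfeld_rel.
by apply: drinfeld_rel_image xy => i r; exact: free_lift_gen.
Qed.

Definition to_yangian : {lrmorphism R -> Y} :=
  presented_lift (E_aug := @reduced_aug K I ip i0) to_yangian_rel.

Definition from_yangian : {lrmorphism Y -> R} :=
  presented_lift (E_aug := @drinfeld_aug K I ip) from_yangian_rel.

Lemma to_yangian_h1 i : to_yangian (h1 i) = yangian_hodd ip i 0.
Proof. exact: presented_lift_gen. Qed.

Lemma to_yangian_b0 i : to_yangian (b0 i) = yangian_b ip i 0.
Proof. exact: presented_lift_gen. Qed.

Lemma to_yangian_b1 i : to_yangian (b1 i) = yangian_b ip i 1.
Proof. exact: presented_lift_gen. Qed.

(** Both families start at b_{i,0} and obey the same recursion under ad(h_{i,1}). *)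
Lemma to_yangian_b_seq i r : to_yangian (rb i r) = yangian_b ip i r.
Proof.
elim: r => [|r IHr]; first exact: to_yangian_b0.
rewrite [rb i r.+1]/= linearZ /= rmorph_commut to_yangian_h1 -/(rb i r) IHr.
rewrite (drinfeld_h1b yangian_rel) scalerA mulVf ?scale1r //.
by rewrite mulf_neq0 ?pnatr_eq0.
Qed.

Lemma to_yangian_h_odd_seq i m : to_yangian (rh i m) = yangian_hodd ip i m.
Proof.
rewrite /rh /h_odd_seq /h_all -/rb linearZ /=.
rewrite (rmorph_bb_defect _ _ _ (to_yangian_b_seq i) (to_yangian_b_seq i)).
rewrite (drinfeld_bb yangian_rel) addn0 /= odd_double /= uphalf_double.
by rewrite scalerA expr0 mulr1 mulrNN mulVf ?scale1r ?pnatr_eq0.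
Qed.

Lemma to_yangianK : cancel to_yangian from_yangian.
Proof.
apply: (presented_alg_ext (p := from_yangian \o to_yangian) (q := idfun)).
case=> [i|[i|i] ] /=; rewrite presented_lift_gen /= presented_lift_gen //=.
- exact: (h_all0 ip_neq0 h1b0 b1b0).
- exact: (b_seq1 ip_neq0 h1b0).
Qed.

Lemma from_yangianK : cancel from_yangian to_yangian.
Proof.
apply: (presented_alg_ext (p := to_yangian \o from_yangian) (q := idfun)).
case=> [] [i r] /=; rewrite presented_lift_gen /=.
- exact: to_yangian_h_odd_seq.
- exact: to_yangian_b_seq.
Qed.

Theorem reduced_yangian_isomorphism :
  exists f : {lrmorphism R -> Y},
    [/\ bijective f,
        forall i, f (h1 i) = yangian_hodd ip i 0,
        forall i, f (b0 i) = yangian_b ip i 0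
      & forall i, f (b1 i) = yangian_b ip i 1].
Proof.
exists to_yangian; split; [|exact: to_yangian_h1|exact: to_yangian_b0|
  exact: to_yangian_b1].
by exists from_yangian; [exact: to_yangianK|exact: from_yangianK].
Qed.

End Isomorphism.

Theorem theorem1 (R : realType) (g : lieAlgType R[i]) (H : {vspace g})
    (I : finType) (alpha : I -> dual_of H) (form : g -> g -> R[i])
    (g_simple : simple_lie g)
    (H_cartan : cartan_subalgebra H)
    (alpha_simple : simple_roots alpha)
    (form_ip : invariant_inner_product alpha form)
    (i0 : I) :
  let ip i j := dual_form form (alpha i) (alpha j) in
  exists f : {lrmorphism reduced_yangian ip i0 -> twisted_yangian ip},
    [/\ bijective f,
        forall i, f (reduced_h1 ip i0 i) = yangian_hodd ip i 0,
        forall i, f (reduced_b0 ip i0 i) = yangian_b ip i 0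
      & forall i, f (reduced_b1 ip i0 i) = yangian_b ip i 1].
Proof.
move=> ip; apply: (reduced_yangian_isomorphism i0).
- exact: (ip_sym form_ip).
- by move=> i; rewrite gt_eqF // (ip_gt0 form_ip).
- exact: (ip_det alpha_simple form_ip).
- exact: (not_isolated g_simple H_cartan alpha_simple form_ip).
Qed.
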